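(* Let $X_1,X_2,\dots$ be i.i.d. with ${\sf E}X_1=0$ and $0<\sigma^2={\sf E}X_1^2<\infty$, let $\lambda>0$ and let $N_\lambda$ be Poisson with parameter $\lambda$ independent of $X_1,X_2,\dots$. Then for every $g\in\mathcal G$ with ${\sf E}X_1^2g(X_1)<\infty$, $$\sup_x\big|{\sf P}\big(S_{N_\lambda}<x\sigma\sqrt{\lambda}\big)-\Phi(x)\big|\le1.8546\,\frac{{\sf E}X_1^2g(X_1)}{\sigma^2g(\sigma\sqrt{\lambda})}.$$
   Context: $S_N=X_1+\dots+X_N$, $S_N=0$ if $N=0$. $\Phi$ is the standard normal distribution function. $\mathcal G$ is the class of functions $g:\mathbb R\to\mathbb R$ such that $g$ is even, $g(x)\ge0$ for all $x$ and $g(x)>0$ for $x>0$, and both $g(x)$ and $x/g(x)$ are nondecreasing on $x>0$. *)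

(* Defs.v *)
From HB Require Import structures.
From mathcomp Require Import all_boot all_order all_algebra.
From mathcomp Require Import all_classical all_reals all_analysis.
Set Implicit Arguments. Unset Strict Implicit. Unset Printing Implicit Defensive.
Import Order.TTheory GRing.Theory Num.Def Num.Theory.
Local Open Scope classical_set_scope.
Local Open Scope ring_scope.

Definition std_normal_cdf {R : realType} (x : R) : R :=
  fine (normal_prob 0 1 `]-oo, x[).

Definition classG {R : realType} (g : R -> R) : Prop :=
  [/\ (forall x, g (- x) = g x),
      (forall x, 0 <= g x),
      (forall x, 0 < x -> 0 < g x),
      (forall x y, 0 < x -> x <= y -> g x <= g y) &
      (forall x y, 0 < x -> x <= y -> x / g x <= y / g y)].

Definition indep_count_seq d (T : measurableType d) (R : realType)
    (P : probability T R) (N : T -> nat) (X : nat -> T -> R) : Prop :=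
  forall (n : nat) (C : set nat) (B : nat -> set R),
    (forall i, measurable (B i)) ->
    P (N @^-1` C `&` \bigcap_(i in `I_n) (X i @^-1` B i)) =
    (P (N @^-1` C) * \prod_(i < n) P (X i @^-1` B i))%E.

Definition ident_distr d (T : measurableType d) (R : realType)
    (P : probability T R) (X : nat -> T -> R) : Prop :=
  forall (i : nat) (B : set R), measurable B ->
    P (X i @^-1` B) = P (X 0%N @^-1` B).

Definition random_sum {T : Type} {R : realType} (N : T -> nat)
    (X : nat -> T -> R) (w : T) : R :=
  \sum_(i < N w) X i w.

(* Main.v *)
(** Stein's method with a zero-bias coupling.  After scaling by [sigma * sqrt lambda],
    let [Y] be a step and [Z] the compound Poisson sum, so that [E Z = 0] and
    [lambda * E Y^2 = 1].  The Poisson identity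
    [E (Z * f Z) = lambda * E (Y * f (Z + Y))], together with [E Y = 0], gives
    [E (Z * f Z) = E (f' (Z + V))] where [V] is independent of [Z] and has law
    [E G(V) = lambda * E (Y^2 * G (U * Y))], [U] uniform on [[0, 1]].  For the solution
    [f] of Stein's equation this turns [P (Z < x) - Phi x] into
    [E (f' Z - f' (Z + V))].  Differences of [f'] are at most 1, which settles the
    part [1 < |Y|]; on [|Y| <= 1] the equation for [f'] leaves a term of size
    [2 * |V|] and the oscillation [P (x - V <= Z < x)].  The latter is controlled since
    [Z + V] has a density bounded by [1/2] (test the identity on piecewise linear
    [f] and use [E |Z| <= 1]): this yields a concentration inequality for [Z] which
    is first bootstrapped and then used to remove [V], at total cost
    [8/21 + 9/20 < 0.8546].  With the 1 from the first two parts, the constant is below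
    [1.8546] in terms of [lambda * E (Y^2 * min 1 |Y|)], and
    [g c * min 1 |x / c| <= g x] for [g] in the class. *)

Require Import Defs.
From HB Require Import structures.
From mathcomp Require Import all_boot all_order all_algebra.
From mathcomp Require Import all_classical all_reals all_analysis measurable_realfun.
From mathcomp Require Import ring lra.
Set Implicit Arguments. Unset Strict Implicit. Unset Printing Implicit Defensive.
Import Order.TTheory GRing.Theory Num.Def Num.Theory.
Import numFieldNormedType.Exports.
Local Open Scope classical_set_scope.
Local Open Scope ring_scope.

(** * Integrability and Fubini for real-valued integrals under probability measures *)

Section integration.
Context {R : realType}.

(** The oscillation bound is gained from the small jumps only, whose weight [w] may be below 1: it
    has slope [1 / (2 * w)] and error of order [M1 / w ^+ 2]. Powers of [w] would spoil the
    constant, but [M1 + (1 - w) <= M < 1] gives [M1 <= w * M], so that [w * M] can replace [M1] and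
    the final quotient by [w] is just [M]. The numbers come from one trade-off. An interval is
    enlarged by [D = theta * e * w], where [e] is the current error. Translations beyond [D] cost
    [C * M1]; the least [C] makes a discriminant vanish, [C * w = 1 / (theta * (4 - theta))]. The
    bootstrap takes [theta = 1/2], close to optimal: [C * w = 4/7] and [e <= 8/7 * M1 / w ^+ 2].
    Removing [V] takes [theta = 2/3]: [C * w = 9/20], and [D / 2] is [8/21 * m / w] when [m] bounds
    [M1]. The Poisson identity is proved for bounded test functions only, hence the clamped
    functions and the caps on all majorants. *)

Lemma bounded_integrable d (T : measurableType d) (P : probability T R)
    (f : T -> R) (K : R) :
  measurable_fun setT f -> (forall x, `|f x| <= K) ->
  P.-integrable setT (EFin \o f).
Proof.
move=> mf fK; apply: measurable_bounded_integrable => //.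
- by rewrite (le_lt_trans (probability_le1 _ _)) ?ltry.
- exists K; split; first exact: num_real.
  by move=> M KM x _ /=; apply: ltW; apply: le_lt_trans KM; exact: fK.
Qed.

Lemma dominated_integrable_real d (T : measurableType d)
    (mu : {measure set T -> \bar R}) (f g : T -> R) :
  measurable_fun setT f -> mu.-integrable setT (EFin \o g) ->
  (forall x, `|f x| <= g x) -> mu.-integrable setT (EFin \o f).
Proof.
move=> mf ig fg; apply: le_integrable ig => //; first exact/measurable_EFinP.
by move=> x _ /=; rewrite lee_fin (le_trans (fg x))// ler_norm.
Qed.

Lemma integrable_normr d (T : measurableType d)
    (mu : {measure set T -> \bar R}) (f : T -> R) :
  mu.-integrable setT (EFin \o f) -> mu.-integrable setT (EFin \o (fun x => `|f x|)).
Proof. by move=> fi; have := integrable_abse fi; apply: eq_integrable. Qed.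

Lemma integrableM_bounded d (T : measurableType d)
    (mu : {measure set T -> \bar R}) (f g : T -> R) (K : R) :
  mu.-integrable setT (EFin \o f) ->
  measurable_fun setT g -> (forall x, `|g x| <= K) ->
  mu.-integrable setT (EFin \o (fun x => f x * g x)).
Proof.
move=> fi mg gK; apply: (@dominated_integrable_real _ _ _ _ (fun x => K * `|f x|)).
- by apply: measurable_funM => //; apply/measurable_EFinP; exact: measurable_int fi.
- by have := integrableZl measurableT K (integrable_normr fi); apply: eq_integrable.
- by move=> x; rewrite normrM mulrC ler_wpM2r.
Qed.

Lemma measurable_fun_integrable d (T : measurableType d)
    (mu : {measure set T -> \bar R}) (f : T -> R) :
  mu.-integrable setT (EFin \o f) -> measurable_fun setT f.
Proof. by move=> /measurable_int /measurable_EFinP. Qed.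

Context d1 d2 (T1 : measurableType d1) (T2 : measurableType d2).
Variables (P1 : probability T1 R) (P2 : probability T2 R).

Lemma integrable_prod_fst (f : T1 -> R) :
  P1.-integrable setT (EFin \o f) ->
  (P1 \x P2)%E.-integrable setT (EFin \o (fun p => f p.1)).
Proof.
move=> fi; have mf := measurable_fun_integrable fi.
apply/integrable12ltyP.
  by apply/measurable_EFinP; exact: (measurableT_comp mf measurable_fst).
move/integrableP: fi => [_]; apply: le_lt_trans.
apply: ge0_le_integral => //.
- by move=> x _; exact: integral_ge0.
- apply: (measurable_fun_fubini_tonelli_F (fun p : T1 * T2 => `|(f p.1)%:E|%E)) => //.
  apply: measurableT_comp => //; apply/measurable_EFinP.
  exact: (measurableT_comp mf measurable_fst).
- by apply: measurableT_comp => //; apply/measurable_EFinP.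
- move=> x _ /=; rewrite integral_cst//.
  by rewrite -[leRHS]mule1 lee_wpmul2l// probability_le1.
Qed.

Lemma integrable_prod_snd (f : T2 -> R) :
  P2.-integrable setT (EFin \o f) ->
  (P1 \x P2)%E.-integrable setT (EFin \o (fun p => f p.2)).
Proof.
move=> fi; have mf := measurable_fun_integrable fi.
apply/integrable21ltyP.
  by apply/measurable_EFinP; exact: (measurableT_comp mf measurable_snd).
move/integrableP: fi => [_]; apply: le_lt_trans.
apply: ge0_le_integral => //.
- by move=> x _; exact: integral_ge0.
- apply: (measurable_fun_fubini_tonelli_G (fun p : T1 * T2 => `|(f p.2)%:E|%E)) => //.
  apply: measurableT_comp => //; apply/measurable_EFinP.
  exact: (measurableT_comp mf measurable_snd).
- by apply: measurableT_comp => //; apply/measurable_EFinP.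
- move=> x _ /=; rewrite integral_cst//.
  by rewrite -[leRHS]mule1 lee_wpmul2l// probability_le1.
Qed.

(** The real-valued inner integral is a [fine], so every section is asked to be integrable, not just
    almost every one: the inner value is then finite everywhere. *)
Lemma Rintegral_prod12 (f : T1 * T2 -> R) :
  (P1 \x P2)%E.-integrable setT (EFin \o f) ->
  (forall x, P2.-integrable setT (EFin \o (fun y => f (x, y)))) ->
  \int[P1]_x \int[P2]_y f (x, y) = \int[(P1 \x P2)%E]_p f p.
Proof.
move=> fi fx; rewrite /Rintegral; congr fine.
rewrite -integral12_prod_meas1//; apply: eq_integral => x _.
by rewrite fineK//; exact: (integrable_fin_num measurableT (fx x)).
Qed.

Lemma Rintegral_prod21 (f : T1 * T2 -> R) :
  (P1 \x P2)%E.-integrable setT (EFin \o f) ->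
  (forall y, P1.-integrable setT (EFin \o (fun x => f (x, y)))) ->
  \int[P2]_y \int[P1]_x f (x, y) = \int[(P1 \x P2)%E]_p f p.
Proof.
move=> fi fx; rewrite /Rintegral; congr fine.
rewrite -integral21_prod_meas1//; apply: eq_integral => x _.
by rewrite fineK//; exact: (integrable_fin_num measurableT (fx x)).
Qed.

Lemma measurable_Rintegral_snd (f : T1 * T2 -> R) :
  (P1 \x P2)%E.-integrable setT (EFin \o f) ->
  measurable_fun setT (fun x => \int[P2]_y f (x, y)).
Proof.
move=> fi; have := measurable_fubini_F fi.
exact: (measurableT_comp (@fine_measurable R setT measurableT)).
Qed.

Lemma measurable_Rintegral_fst (f : T1 * T2 -> R) :
  (P1 \x P2)%E.-integrable setT (EFin \o f) ->
  measurable_fun setT (fun y => \int[P1]_x f (x, y)).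
Proof.
move=> fi; have := measurable_fubini_G fi.
exact: (measurableT_comp (@fine_measurable R setT measurableT)).
Qed.

End integration.

Lemma Rintegral_cst_prob d (T : measurableType d) (R : realType)
  (P : probability T R) (K : R) : \int[P]_x K = K.
Proof.
transitivity (K * fine (P setT)); first exact: Rintegral_cst.
by rewrite probability_setT mulr1.
Qed.

Lemma Rintegral_le_bound d (T : measurableType d) (R : realType) (P : probability T R)
    (f : T -> R) (K : R) : P.-integrable setT (EFin \o f) ->
  (forall x, f x <= K) -> \int[P]_x f x <= K.
Proof.
move=> fi fK.
rewrite -[leRHS](Rintegral_cst_prob P).
apply: le_Rintegral => //; exact: (@bounded_integrable _ _ _ _ _ `|K|).
Qed.

Lemma Rintegral_norm_bound d (T : measurableType d) (R : realType) (P : probability T R)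
    (f : T -> R) (K : R) : P.-integrable setT (EFin \o f) ->
  (forall x, `|f x| <= K) -> `|\int[P]_x f x| <= K.
Proof.
move=> fi fK; apply: (le_trans (le_normr_Rintegral _ fi)) => //.
by apply: Rintegral_le_bound => //; exact: integrable_normr.
Qed.

(** * Normal distribution function, Mills ratio and the solution of Stein's equation *)

Section gauss.
Context {R : realType}.
Implicit Types x y z v : R.
Local Notation phi := (normal_pdf (0 : R) 1).
Local Notation Phi := (@std_normal_cdf R).

Lemma phiE x : phi x = normal_peak 1 * expR (- (x ^+ 2 / 2)).
Proof.
rewrite normal_pdfE ?oner_neq0// /normal_fun subr0 expr1n.
by rewrite mulNr mulr2n.
Qed.

Lemma phi_gt0 x : 0 < phi x.
Proof. by rewrite phiE mulr_gt0 ?expR_gt0// normal_peak_gt0// oner_neq0. Qed.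

Lemma phiN x : phi (- x) = phi x.
Proof. by rewrite !phiE sqrrN. Qed.

Lemma phi_le_half x : phi x <= 2^-1.
Proof.
apply: (le_trans (normal_pdf_ub _ _ (oner_neq0 _))).
have pi0 : 0 < (pi : R) *+ 2 by rewrite pmulrn_lgt0// pi_gt0.
rewrite /normal_peak expr1n mul1r lef_pV2 ?posrE ?sqrtr_gt0//.
have {1}-> : (2 : R) = sqrtr (2 ^+ 2) by rewrite sqrtr_sqr ger0_norm.
by apply: ler_wsqrtr; rewrite expr2 -[leRHS]mulr_natr ler_pM2r// pi_ge2.
Qed.

Lemma is_derive_phi x : is_derive x 1 phi (- x * phi x).
Proof.
have -> : phi = (fun y => normal_peak 1 * expR (- (y ^+ 2 / 2))).
  by apply/funext => y; rewrite phiE.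
apply: is_derive_eq.
by rewrite /GRing.scale/=; field.
Qed.

Lemma PhiE x : Phi x = \int[lebesgue_measure]_(t in `]-oo, x]) phi t.
Proof.
rewrite /std_normal_cdf /normal_prob -/(Rintegral _ _ _).
rewrite Rintegral_itv_bndo_bndc//.
by apply: integrableS (integrable_normal_pdf 0 1).
Qed.

Lemma is_derive_Phi x : is_derive x 1 Phi (phi x).
Proof.
have x1 : x < x + 1 by rewrite ltrDl.
have intf : lebesgue_measure.-integrable `]-oo, x + 1] (EFin \o phi).
  by apply: integrableS (integrable_normal_pdf 0 1).
have [] := @continuous_FTC1 R phi -oo%O x (x + 1) x1 intf.
- by rewrite ltNyr.
- exact/continuous_normal_pdf/oner_neq0.
have -> : (fun y : R => \int[lebesgue_measure]_(t in `]-oo, y]) phi t) = Phi.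
  by apply/funext => y; rewrite PhiE.
by move=> dP <-; rewrite derive1E; exact: derivableP.
Qed.

Lemma Phi_ge0 x : 0 <= Phi x.
Proof. by rewrite /std_normal_cdf fine_ge0. Qed.

Lemma Phi_le1 x : Phi x <= 1.
Proof.
rewrite /std_normal_cdf -lee_fin fineK ?fin_num_measure//.
by rewrite probability_le1.
Qed.

(** The identity, seen as a random variable under the normal law, has [std_normal_cdf] as
    distribution function; the limits at both infinities then come from the theory of [cdf]. *)
Let idRR : measurableTypeR R -> R := idfun.

#[local] HB.instance Definition _ :=
  @isMeasurableFun.Build _ _ _ _ idRR (@measurable_id _ _ setT).

Local Notation Pcdf := (cdf (P := normal_prob (0 : R) 1) (idRR : {RV (normal_prob (0 : R) 1) >-> R})).

Lemma Phi_cdf x : (Phi x)%:E = Pcdf x.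
Proof.
by rewrite PhiE /Rintegral fineK// -/(normal_prob 0 1 _) fin_num_measure.
Qed.

Lemma Phi_lt_small (e : R) x : 0 < e -> exists2 z, z < x & Phi z < e.
Proof.
move=> e0.
have := cvg_cdfNy0 (idRR : {RV (normal_prob (0:R) 1) >-> R}).
move=> /fine_cvgP[_] /cvgr0Pnorm_lt /(_ e e0) H.
near (-oo%R : set_system R) => z; exists z.
  by near: z; apply: nbhs_ninfty_lt; exact: num_real.
have : `|fine (Pcdf z)| < e.
  by near: z.
by rewrite -Phi_cdf/= ger0_norm// Phi_ge0.
Unshelve. all: by end_near. Qed.

Lemma Phi_gt_large (e : R) x : 0 < e -> exists2 z, x < z & 1 - e < Phi z.
Proof.
move=> e0.
have := cvg_cdfy1 (idRR : {RV (normal_prob (0:R) 1) >-> R}).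
move=> /fine_cvgP[_] /cvgrPdist_lt /(_ e e0) H.
near (+oo%R : set_system R) => z; exists z.
  by near: z; apply: nbhs_pinfty_gt; exact: num_real.
have : `|1 - fine (Pcdf z)| < e.
  by near: z.
rewrite -Phi_cdf/= => /(le_lt_trans (ler_norm _)); lra.
Unshelve. all: by end_near. Qed.

Lemma is_derive_continuous (f : R -> R) x (df : R) : is_derive x 1 f df -> {for x, continuous f}.
Proof. by move=> []; move=> /derivable1_diffP /differentiable_continuous. Qed.

Lemma derive_monotone (f df : R -> R) a b : a <= b ->
  (forall y, a <= y <= b -> is_derive y 1 f (df y)) ->
  (forall y, a <= y <= b -> 0 <= df y) -> f a <= f b.
Proof.
move=> ab fd df0.
have [||c cab E] := @MVT_segment R f df a b ab.
- by move=> y; rewrite in_itv/= => /andP[/ltW ay /ltW yb]; apply: fd; rewrite ay.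
- apply: continuous_in_subspaceT => y; rewrite inE/= in_itv/= => yab.
  exact/is_derive_continuous/fd.
by rewrite -subr_ge0 E mulr_ge0 ?subr_ge0// df0// -in_itv.
Qed.

(** Stands in for a limit at minus infinity: for a nondecreasing [f], one point with value at least
    [- e] for each [e] is enough. It serves both Mills ratio bounds. *)
Lemma ge0_from_ninfty (f df : R -> R) x :
  (forall y, y <= x -> is_derive y 1 f (df y)) ->
  (forall y, y <= x -> 0 <= df y) ->
  (forall e, 0 < e -> exists2 z, z <= x & - e <= f z) -> 0 <= f x.
Proof.
move=> fd df0 H; rewrite leNgt; apply/negP => fx0.
have [|z zx fz] := H (- (f x) / 2); first by rewrite divr_gt0// oppr_gt0.
have := derive_monotone zx (fun y yzx => fd y (proj2 (andP yzx)))
  (fun y yzx => df0 y (proj2 (andP yzx))).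
lra.
Qed.

(** The sum [Phi y + Phi (- y)] has derivative [phi y - phi (- y) = 0]; the left tail bounds this
    constant by 1 from above, the right tail from below. *)
Lemma Phi_N x : Phi (- x) = 1 - Phi x.
Proof.
have D y : is_derive y 1 (fun y => Phi y + Phi (- y)) 0.
  have d1 := is_derive_Phi y; have d2 := is_derive_Phi (- y).
  have d3 : is_derive y 1 (fun y => Phi (- y)) (- phi (- y)).
    by have := is_derive1_comp d2 (is_deriveNid y 1); rewrite mulrN1.
  by apply: is_derive_eq; rewrite phiN subrr.
suff E : Phi x + Phi (- x) = 1 by rewrite -E addrAC subrr add0r.
have C y : Phi y + Phi (- y) = Phi x + Phi (- x).
  exact: (@is_derive_0_is_cst R (fun y => Phi y + Phi (- y)) y x D).
apply/eqP; rewrite eq_le; apply/andP; split; apply/ler_addgt0Pl => e e0.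
- have [z z0 ze] := @Phi_lt_small e 0 e0.
  by rewrite -(C z) lerD ?Phi_le1// ltW.
- have [z z0 ze] := @Phi_gt_large e 0 e0.
  by rewrite -(C z); have := Phi_ge0 (- z); lra.
Qed.

Lemma Phi0 : Phi 0 = 2^-1.
Proof. have := Phi_N 0; rewrite oppr0; lra. Qed.

(** For [z < 0] the function [phi z / (- z) - Phi z] has derivative [phi z / z ^+ 2], and it is at
    least [- Phi z], which vanishes at minus infinity. *)
Lemma mills_upper z : 0 <= phi z + z * Phi z.
Proof.
have [z0|z0] := leP 0 z; first by rewrite addr_ge0 ?mulr_ge0 ?Phi_ge0// ltW// phi_gt0.
suff : 0 <= phi z * (- z)^-1 - Phi z.
  rewrite subr_ge0 ler_pdivlMr ?oppr_gt0//; nra.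
pose df y := phi y * (- y) ^- 2.
apply: (@ge0_from_ninfty (fun y => phi y * (- y)^-1 - Phi y) df).
- move=> y yz; have y0 : - y != 0 by rewrite oppr_eq0 lt_eqF// (le_lt_trans yz).
  have d1 := is_derive_Phi y; have d2 := is_derive_phi y.
  have d3 : is_derive y 1 (fun y => (- y)^-1) ((- y) ^- 2).
    have := is_deriveV y0 (is_deriveNid y 1).
    by rewrite scalerN scaleNr opprK /GRing.scale/= mulr1.
  apply: is_derive_eq; rewrite /df /GRing.scale/=; field.
  by rewrite -oppr_eq0.
- by move=> y _; rewrite mulr_ge0 ?invr_ge0 ?sqr_ge0// ltW// phi_gt0.
- move=> e e0; have [y yz ye] := @Phi_lt_small e z e0; exists y; first exact: ltW.
  have : 0 <= phi y * (- y)^-1.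
    by rewrite mulr_ge0 ?invr_ge0 ?oppr_ge0 ?(ltW (phi_gt0 _))// ltW// (lt_trans yz).
  lra.
Qed.

(** Up to the factor [phi v], this is the nonnegativity of the derivative of [z * mills z]. It holds
    because [Phi v + v * phi v / (1 + v ^+ 2)] has derivative [2 * phi v / (1 + v ^+ 2) ^+ 2]. *)
Lemma mills_lower v : 0 <= v * phi v + (1 + v ^+ 2) * Phi v.
Proof.
have p y : 0 < 1 + y ^+ 2 by rewrite ltr_pwDl ?sqr_ge0.
suff : 0 <= Phi v + v * phi v / (1 + v ^+ 2).
  rewrite -(@pmulr_rge0 _ (1 + v ^+ 2))// mulrDr mulrCA divff ?mulr1 ?gt_eqF//.
  by rewrite addrC.
pose df y := 2 * phi y / (1 + y ^+ 2) ^+ 2.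
apply: (@ge0_from_ninfty (fun y => Phi y + y * phi y * (1 + y ^+ 2)^-1) df).
- move=> y _; have d1 := is_derive_Phi y; have d2 := is_derive_phi y.
  have d3 : is_derive y 1 (fun y => (1 + y ^+ 2)^-1) (- (1 + y ^+ 2) ^- 2 * (2 * y)).
    apply: is_derive_eq; first by apply: is_deriveV; rewrite gt_eqF.
    by rewrite /GRing.scale/= /cst; ring.
  apply: is_derive_eq; rewrite /df /GRing.scale/=; field.
  by rewrite gt_eqF.
- by move=> y _; rewrite /df divr_ge0 ?sqr_ge0// mulr_ge0// ltW// phi_gt0.
- move=> e e0; exists (Num.min v (- e^-1 - 1)); first by rewrite ge_min lexx.
  set y := Num.min _ _.
  have ye : y <= - e^-1 - 1 by rewrite ge_min lexx orbT.
  have ie : 0 < e^-1 by rewrite invr_gt0.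
  (* For [y <= - e^-1] the quotient is below [1 / |y| <= e] in absolute value. *)
  have : - e <= y * phi y / (1 + y ^+ 2).
    rewrite ler_pdivlMr//.
    have h1 := phi_le_half y; have h2 := phi_gt0 y.
    have h3 : 1 <= e * - y.
      by rewrite -(mulfV (lt0r_neq0 e0)) ler_pM2l//; lra.
    nra.
  have := Phi_ge0 y; lra.
Qed.

(** The Mills ratio of the left tail. It solves [m' - z * m = 1], so suitable multiples of it and of
    its reflection solve Stein's equation on either side of [x]. *)
Definition mills x := Phi x / phi x.

Lemma mills_ge0 x : 0 <= mills x.
Proof. by rewrite divr_ge0 ?Phi_ge0// ltW// phi_gt0. Qed.

Lemma is_derive_mills x : is_derive x 1 mills (1 + x * mills x).
Proof.
have d1 := is_derive_Phi x; have d2 := is_derive_phi x.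
have p0 : phi x != 0 by rewrite gt_eqF// phi_gt0.
have d3 := is_deriveV p0 d2.
apply: is_derive_eq; rewrite /mills /GRing.scale/=; field.
exact: p0.
Qed.

Lemma mills_derive_ge0 x : 0 <= 1 + x * mills x.
Proof.
have p0 := phi_gt0 x.
rewrite -(pmulr_rge0 _ p0) mulrDr mulr1 /mills mulrCA (mulrCA (phi x)).
by rewrite mulfV ?mulr1 ?mills_upper// gt_eqF.
Qed.

Lemma mills_monotone x y : x <= y -> mills x <= mills y.
Proof.
move=> xy; apply: (derive_monotone (df := fun x => 1 + x * mills x)) => // z _.
- exact: is_derive_mills.
- exact: mills_derive_ge0.
Qed.

Lemma mul_mills_monotone x y : x <= y -> x * mills x <= y * mills y.
Proof.
move=> xy.
apply: (derive_monotone (f := fun z => z * mills z)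
  (df := fun z => z + (1 + z ^+ 2) * mills z)) => // z _.
- have d := is_derive_mills z.
  by apply: is_derive_eq; rewrite /GRing.scale/=; ring.
- have p0 := phi_gt0 z; rewrite -(pmulr_rge0 _ p0) mulrDr /mills mulrCA.
  rewrite (mulrCA (phi z)) mulfV ?gt_eqF// mulr1 (mulrC (phi z)).
  exact: mills_lower.
Qed.

Lemma Phi_half_slope x : 0 <= x -> Phi x <= 2^-1 + x / 2.
Proof.
move=> x0; rewrite -subr_ge0.
have := @derive_monotone (fun z => z / 2 - Phi z) (fun z => 2^-1 - phi z) 0 x x0.
rewrite Phi0 mul0r sub0r => H.
suff : - 2^-1 <= x / 2 - Phi x by lra.
apply: H => z _; last by rewrite subr_ge0 phi_le_half.
have d := is_derive_Phi z.
by apply: is_derive_eq; rewrite /GRing.scale/=; ring.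
Qed.

(** By symmetry [x >= 0]. For [x >= 1] it follows from [x * (1 - Phi x) <= phi x]. On [[0, 1]] the
    difference of the two sides is monotone, because [2 * Phi z <= 1 + z], so the case [x = 1]
    decides. *)
Lemma Phi_PhiN_le_phi x : Phi x * (1 - Phi x) <= phi x.
Proof.
wlog x0 : x / 0 <= x.
  move=> H; have [|/ltW x0] := leP 0 x; first exact: H.
  have := H (- x); rewrite oppr_ge0 Phi_N phiN => /(_ x0).
  by rewrite opprB addrCA subrr addr0 mulrC.
have M y : 1 <= y -> Phi y * (1 - Phi y) <= phi y.
  move=> y1; have := mills_upper (- y); rewrite phiN Phi_N.
  have h1 := Phi_ge0 y; have h2 := Phi_le1 y.
  move: (Phi y) (phi y) h1 h2 => p q; nra.
have [x1|/ltW x1] := leP 1 x; first exact: M.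
rewrite -subr_ge0 -oppr_le0.
apply: (@le_trans _ _ (- (phi 1 - Phi 1 * (1 - Phi 1)))); last first.
  by rewrite oppr_le0 subr_ge0 M.
apply: (derive_monotone (f := fun x => - (phi x - Phi x * (1 - Phi x)))
  (df := fun z => phi z * (1 + z - 2 * Phi z))) => // z /andP[xz z1].
- have d1 := is_derive_Phi z; have d2 := is_derive_phi z.
  by apply: is_derive_eq; rewrite /GRing.scale/=; ring.
- rewrite mulr_ge0 ?(ltW (phi_gt0 _))//.
  have := Phi_half_slope (le_trans x0 xz); lra.
Qed.

(* [stein x] solves Stein's equation f'(z) - z f(z) = 1(z < x) - Phi x, and
   [stein_deriv x] is its derivative (away from [x]). *)
Definition stein x z :=
  if z < x then mills z * (1 - Phi x) else mills (- z) * Phi x.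

Definition stein_deriv x z := z * stein x z + (z < x)%R%:R - Phi x.

Lemma stein_ge0 x z : 0 <= stein x z.
Proof.
by rewrite /stein; case: ifP => _; rewrite mulr_ge0 ?mills_ge0 ?subr_ge0 ?Phi_le1 ?Phi_ge0.
Qed.

(** As [mills] is nondecreasing, both branches are largest at [x], where they equal
    [Phi x * (1 - Phi x) / phi x]. *)
Lemma stein_le1 x z : stein x z <= 1.
Proof.
have p0 := phi_gt0 x.
have H : Phi x * (1 - Phi x) / phi x <= 1.
  by rewrite ler_pdivrMr// mul1r Phi_PhiN_le_phi.
apply: le_trans H; rewrite /stein; case: ltP => zx.
- rewrite [leRHS]mulrAC ler_wpM2r ?subr_ge0 ?Phi_le1//.
  exact/mills_monotone/ltW.
- rewrite -mulrA mulrC ler_wpM2l ?Phi_ge0// -Phi_N -phiN.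
  by apply: mills_monotone; rewrite lerN2.
Qed.

Lemma stein_derivE x z : stein_deriv x z =
  if z < x then (1 - Phi x) * (1 + z * mills z)
  else - (Phi x * (1 + (- z) * mills (- z))).
Proof. by rewrite /stein_deriv /stein; case: ltP => _ /=; ring. Qed.

(** As [z * mills z] is nondecreasing, the derivative increases from nonnegative values on the left
    of [x] and through nonpositive values on the right; its extremes are the one-sided values at
    [x]. *)
Lemma stein_deriv_range x z :
  - (Phi x * (1 + (- x) * mills (- x))) <= stein_deriv x z
    <= (1 - Phi x) * (1 + x * mills x).
Proof.
have p1 := Phi_ge0 x; have p2 : 0 <= 1 - Phi x by rewrite subr_ge0 Phi_le1.
rewrite stein_derivE; case: ltP => zx.
- rewrite ler_wpM2l ?lerD2l ?mul_mills_monotone ?(ltW zx)// andbT.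
  apply: (@le_trans _ _ 0); last by rewrite mulr_ge0// mills_derive_ge0.
  by rewrite oppr_le0 mulr_ge0// mills_derive_ge0.
- rewrite lerN2 ler_wpM2l ?lerD2l ?mul_mills_monotone ?lerN2//=.
  apply: (@le_trans _ _ 0); last by rewrite mulr_ge0// mills_derive_ge0.
  by rewrite oppr_le0 mulr_ge0// mills_derive_ge0.
Qed.

(** The jump at [x] is exactly 1, since the Mills terms of the two one-sided values cancel. This is
    why large jumps cost no more than their weight. *)
Lemma stein_deriv_diff x v w : stein_deriv x v - stein_deriv x w <= 1.
Proof.
have /andP[_ h1] := stein_deriv_range x v.
have /andP[h2 _] := stein_deriv_range x w.
have <- : (1 - Phi x) * (1 + x * mills x) + Phi x * (1 + (- x) * mills (- x)) = 1.
  rewrite /mills Phi_N phiN; field.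
  by rewrite gt_eqF// phi_gt0.
by lra.
Qed.

Lemma stein_deriv_bound x v : `|stein_deriv x v| <= 1.
Proof.
have /andP[h2 h1] := stein_deriv_range x v.
have p1 : 0 <= Phi x * (1 + (- x) * mills (- x)).
  by rewrite mulr_ge0 ?Phi_ge0// mills_derive_ge0.
have p2 : 0 <= (1 - Phi x) * (1 + x * mills x).
  by rewrite mulr_ge0 ?subr_ge0 ?Phi_le1// mills_derive_ge0.
have E : (1 - Phi x) * (1 + x * mills x) + Phi x * (1 + (- x) * mills (- x)) = 1.
  rewrite /mills Phi_N phiN; field.
  by rewrite gt_eqF// phi_gt0.
by rewrite ler_norml; lra.
Qed.

End gauss.

(** * The fundamental theorem of calculus as a uniform average, across one jump *)

Section uniform_average.
Context {R : realType}.
Implicit Types (h B : R -> R) (a b c t u x y z K : R).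
Local Notation mu := (@lebesgue_measure R).
Local Notation U := (uniform_prob (@ltr01 R)).

Lemma Rintegral_uniform h : measurable_fun setT h ->
  \int[U]_u h u = \int[mu]_(u in `[0, 1]) h u.
Proof.
move=> mh; congr fine; rewrite integralE [RHS]integralE.
have mh' : measurable_fun setT (EFin \o h) by exact/measurable_EFinP.
by congr (_ - _)%E; rewrite integral_uniform ?subr0 ?invr1 ?mul1e//;
  [exact: measurable_funepos|exact: measurable_funeneg].
Qed.

Lemma Rintegral_FTC h (h' : R -> R) B a b : a <= b ->
  measurable_fun setT h -> continuous h' ->
  (forall u, is_derive u 1 B (h' u)) ->
  (forall u, a < u -> u < b -> h u = h' u) ->
  \int[mu]_(u in `[a, b]) h u = B b - B a.
Proof.
move=> ab mh ch' dB hh'.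
move: ab; rewrite le_eqVlt => /predU1P[->|ab].
  by rewrite set_itv1 Rintegral_set1 subrr.
have mh'' : measurable_fun setT h' by exact: continuous_measurable_fun.
rewrite /Rintegral.
rewrite -integral_itv_obnd_cbnd; last exact/measurable_EFinP/measurable_funTS.
rewrite -integral_itv_bndo_bndc; last exact/measurable_EFinP/measurable_funTS.
have -> : (\int[mu]_(u in `]a, b[) (h u)%:E = \int[mu]_(u in `]a, b[) (h' u)%:E)%E.
  apply: eq_integral => u; rewrite inE/= in_itv/= => /andP[au ub].
  by rewrite hh'.
rewrite integral_itv_bndo_bndc; last exact/measurable_EFinP/measurable_funTS.
rewrite integral_itv_obnd_cbnd; last exact/measurable_EFinP/measurable_funTS.
have cB : continuous B.
  by move=> u; have [+ _] := dB u => /derivable1_diffP/differentiable_continuous.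
rewrite (@continuous_FTC2 R h' B a b)//.
- exact: continuous_subspaceT.
- split.
  + by move=> u _; have [] := dB u.
  + exact/cvg_at_right_filter/cB.
  + exact/cvg_at_left_filter/cB.
- by move=> u _; rewrite derive1E; have [_ ->] := dB u.
Qed.

(** The point [c] may lie inside or outside the unit interval, and [h c] is left free because a
    single point does not affect the integral. *)
Lemma Rintegral01_glue h (h1 h2 : R -> R) B1 B2 c K :
  measurable_fun setT h -> (forall u, 0 <= u <= 1 -> `|h u| <= K) ->
  continuous h1 -> continuous h2 ->
  (forall u, is_derive u 1 B1 (h1 u)) -> (forall u, is_derive u 1 B2 (h2 u)) ->
  (forall u, u < c -> h u = h1 u) -> (forall u, c < u -> h u = h2 u) ->
  B1 c = B2 c ->
  \int[mu]_(u in `[0, 1]) h u =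
    (if 1 <= c then B1 1 else B2 1) - (if 0 <= c then B1 0 else B2 0).
Proof.
move=> mh hK c1 c2 d1 d2 e1 e2 B12.
have [oc|co] := leP 1 c.
  rewrite (le_trans _ oc)//; apply: (@Rintegral_FTC _ h1) => // u _ u1.
  by apply: e1; exact: lt_le_trans oc.
have [c0|c0] := leP 0 c; last first.
  by apply: (@Rintegral_FTC _ h2) => // u u0 _; apply: e2; exact: lt_trans u0.
have ih : mu.-integrable `[0, 1] (EFin \o h).
  apply: measurable_bounded_integrable => //.
  - by rewrite /= lebesgue_measure_itv/= lte_fin ltr01 ltry.
  - exact: measurable_funTS.
  - exists K; split; first exact: num_real.
    move=> M KM u /=; rewrite in_itv/= => u01; apply: ltW.
    by apply: le_lt_trans KM; exact: hK.
have := @Rintegral_itvB R h (BLeft 0) (BRight 1) c ih.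
rewrite !bnd_simp => /(_ c0 (ltW co)).
rewrite Rintegral_itv_obnd_cbnd; last first.
  apply: integrableS ih => //; apply: subset_itvr; rewrite bnd_simp.
  exact: c0.
rewrite (@Rintegral_FTC _ h1 B1 0 c)//; last by move=> u _ uc; exact: e1.
rewrite (@Rintegral_FTC _ h2 B2 c 1) ?(ltW co)//; last by move=> u cu _; exact: e2.
rewrite B12 => /eqP; rewrite subr_eq => /eqP ->; ring.
Qed.

Lemma uniform_integrable h K : measurable_fun setT h ->
  (forall u, 0 <= u <= 1 -> `|h u| <= K) -> U.-integrable setT (EFin \o h).
Proof.
move=> mh hK; apply/integrableP; split; first exact/measurable_EFinP.
rewrite integral_uniform//; last by apply/measurable_EFinP; exact: measurableT_comp.
rewrite subr0 invr1 mul1e.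
apply: (@le_lt_trans _ _ (\int[mu]_(u in `[0%R, 1%R]) K%:E)%E).
  apply: ge0_le_integral; [by []|by []| |by []|].
    by apply/measurable_EFinP/measurable_funTS; exact: measurableT_comp.
  by move=> u /=; rewrite in_itv/= => u01; rewrite lee_fin; exact: hK.
by rewrite integral_cst//= lebesgue_measure_itv/= lte_fin ltr01 -EFinB -EFinM ltry.
Qed.

(** A mean value formula for a primitive with a kink at [x]. In the variable [u] the jump sits at
    [(x - z) / y]. *)
Lemma uniform_average_glue (f1 f2 b1 b2 : R -> R) x z y K :
  let b t := if t < x then b1 t else b2 t in
  let f t := if t < x then f1 t else f2 t in
  measurable_fun setT b -> (forall u, 0 <= u <= 1 -> `|b (z + u * y)| <= K) ->
  continuous b1 -> continuous b2 ->
  (forall t, is_derive t 1 f1 (b1 t)) -> (forall t, is_derive t 1 f2 (b2 t)) ->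
  f1 x = f2 x ->
  y * \int[U]_u b (z + u * y) = f (z + y) - f z.
Proof.
move=> b f mb bK c1 c2 d1 d2 fx.
have [->|y0] := eqVneq y 0; first by rewrite mul0r addr0 subrr.
have aff : continuous (fun u : R => z + u * y).
  move=> u; apply: cvgD; first exact: cvg_cst.
  by apply: cvgM; [exact: cvg_id|exact: cvg_cst].
have maff : measurable_fun setT (fun u : R => z + u * y).
  exact: continuous_measurable_fun.
have mby : measurable_fun setT (fun u => b (z + u * y)).
  exact: (measurableT_comp mb maff).
have ib : U.-integrable setT (EFin \o (fun u => b (z + u * y))).
  exact: uniform_integrable bK.
rewrite -RintegralZl// Rintegral_uniform; last exact: measurable_funM.
have ci g : continuous g -> continuous (fun u : R => y * g (z + u * y)).
  move=> cg u; apply: cvgM; first exact: cvg_cst.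
  exact: (continuous_comp (aff u) (cg _)).
have di (g dg : R -> R) : (forall t, is_derive t 1 g (dg t)) -> forall u,
    is_derive u 1 (fun u => g (z + u * y)) (y * dg (z + u * y)).
  move=> H u; have h1 : is_derive u 1 (fun u : R => z + u * y) y.
    by apply: is_derive_eq; rewrite /GRing.scale/=; ring.
  by have := @is_derive1_comp R g (fun u : R => z + u * y) u _ _ (H _) h1; rewrite mulrC.
have bK' u : 0 <= u <= 1 -> `|y * b (z + u * y)| <= `|y| * K.
  by move=> u01; rewrite normrM ler_wpM2l// bK.
have xc : z + (x - z) / y * y = x by rewrite divfK// addrC subrK.
(* The branches agree at [x], so the boundary case may go to either; this form serves [y > 0] and
   the next one [y < 0]. *)
have fE t : f t = if t <= x then f1 t else f2 t.
  by rewrite /f; case: ltgtP => // ->.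
have fE' t : f t = if x <= t then f2 t else f1 t.
  by rewrite /f; case: leP.
have mby' : measurable_fun setT (fun u => y * b (z + u * y)).
  exact: measurable_funM.
have [yp|yn|/eqP] := ltgtP 0 y; last by rewrite eq_sym (negbTE y0).
- rewrite (@Rintegral01_glue _ (fun u => y * b1 (z + u * y))
    (fun u => y * b2 (z + u * y)) (fun u => f1 (z + u * y))
    (fun u => f2 (z + u * y)) ((x - z) / y) (`|y| * K) mby' bK' (ci _ c1)
    (ci _ c2) (di _ _ d1) (di _ _ d2)).
  + rewrite mul1r mul0r addr0 !ler_pdivlMr// mul1r mul0r !fE.
    by rewrite lerBrDl subr_ge0.
  + by move=> u; rewrite ltr_pdivlMr// /b => h; rewrite ifT//; lra.
  + by move=> u; rewrite ltr_pdivrMr// /b => h; rewrite ifF//; lra.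
  + by rewrite xc.
(* A negative [y] reverses the order, so the two branches trade places. *)
- rewrite (@Rintegral01_glue _ (fun u => y * b2 (z + u * y))
    (fun u => y * b1 (z + u * y)) (fun u => f2 (z + u * y))
    (fun u => f1 (z + u * y)) ((x - z) / y) (`|y| * K) mby' bK' (ci _ c2)
    (ci _ c1) (di _ _ d2) (di _ _ d1)).
  + rewrite mul1r mul0r addr0 !ler_ndivlMr// mul1r mul0r !fE'.
    by rewrite lerBlDl subr_le0.
  + by move=> u; rewrite ltr_ndivlMr// /b => h; rewrite ifF//; lra.
  + by move=> u; rewrite ltr_ndivrMr// /b => h; rewrite ifT//; lra.
  + by rewrite xc.
Qed.

(* [lebesgue_measure] lives on a copy of [R] with another display; [unif01] is
   the uniform law seen as a probability on [R] itself. *)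
Definition id_measurableTypeR : measurableTypeR R -> R := id.

Lemma measurable_id_measurableTypeR : measurable_fun setT id_measurableTypeR.
Proof. by move=> _ A mA; rewrite setTI. Qed.

HB.instance Definition _ := isMeasurableFun.Build _ _ _ _
  id_measurableTypeR measurable_id_measurableTypeR.

Definition unif01 : probability R R :=
  [the probability R R of distribution U (id_measurableTypeR : {RV U >-> R})].

Lemma Rintegral_unif01 h : measurable_fun setT h -> \int[unif01]_u h u = \int[U]_u h u.
Proof.
move=> mh; congr fine; rewrite integralE [RHS]integralE.
have mh' : measurable_fun setT (EFin \o h) by exact/measurable_EFinP.
by congr (_ - _)%E; rewrite (@ge0_integral_pushforward _ _ _ _ R _ measurable_id_measurableTypeR U setT)//;
  [exact: measurable_funepos|exact: measurable_funeneg].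
Qed.

Lemma unif01_average_glue (b f f1 f2 b1 b2 : R -> R) x z y K :
  (forall t, b t = if t < x then b1 t else b2 t) ->
  (forall t, f t = if t < x then f1 t else f2 t) ->
  measurable_fun setT b -> (forall u, 0 <= u <= 1 -> `|b (z + u * y)| <= K) ->
  continuous b1 -> continuous b2 ->
  (forall t, is_derive t 1 f1 (b1 t)) -> (forall t, is_derive t 1 f2 (b2 t)) ->
  f1 x = f2 x ->
  y * \int[unif01]_u b (z + u * y) = f (z + y) - f z.
Proof.
move=> /funext -> /funext -> mb bK c1 c2 d1 d2 fx.
rewrite -(@uniform_average_glue f1 f2 b1 b2 x z y K)//; congr (_ * _).
apply: Rintegral_unif01; apply: (measurableT_comp mb).
by apply: measurable_funD => //; exact: measurable_funM.
Qed.

End uniform_average.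

(** * Regularity of the Stein solution and its averaged derivative *)

Section stein_average.
Context {R : realType}.
Implicit Types (f : R -> R) (x z y : R).
Local Notation Phi := (@std_normal_cdf R).

Lemma measurable_glue x f1 f2 : measurable_fun setT f1 -> measurable_fun setT f2 ->
  measurable_fun setT (fun z => if z < x then f1 z else f2 z).
Proof.
move=> m1 m2; apply: measurable_fun_if => //; last 2 first.
- exact: measurable_funTS.
- exact: measurable_funTS.
by apply: measurable_fun_ltr => //; exact: measurable_id.
Qed.

Lemma continuous_mills : continuous (@mills R).
Proof. by move=> z; exact: is_derive_continuous (is_derive_mills z). Qed.

Lemma continuous_mulr_mills (c : R) : continuous (fun z : R => c * (1 + z * mills z)).
Proof.
move=> z; apply: cvgM; first exact: cvg_cst.
apply: cvgD; first exact: cvg_cst.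
by apply: cvgM; [exact: cvg_id|exact: continuous_mills].
Qed.

Lemma continuous_compN f : continuous f -> continuous (fun z => f (- z)).
Proof. by move=> cf z; apply: continuous_comp; [exact: opp_continuous|exact: cf]. Qed.

Lemma continuous_mulr_millsN (c : R) :
  continuous (fun z : R => c * (1 + (- z) * mills (- z))).
Proof.
have cN : continuous (fun z : R => - z) by move=> z; exact: opp_continuous.
move=> z; apply: cvgM; first exact: cvg_cst.
apply: cvgD; first exact: cvg_cst.
apply: cvgM; first exact: cN.
exact: (continuous_compN continuous_mills (x := z)).
Qed.

Lemma measurable_stein x : measurable_fun setT (stein x).
Proof.
apply: (@measurable_glue x (fun z => mills z * (1 - Phi x)) (fun z => mills (- z) * Phi x)).
- apply: measurable_funM => //; apply: continuous_measurable_fun.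
  exact: continuous_mills.
- apply: measurable_funM => //; apply: continuous_measurable_fun.
  exact/continuous_compN/continuous_mills.
Qed.

Lemma measurable_stein_deriv x : measurable_fun setT (stein_deriv x).
Proof.
have -> : stein_deriv x = (fun z => if z < x then (1 - Phi x) * (1 + z * mills z)
    else - (Phi x * (1 + (- z) * mills (- z)))).
  by apply/funext => z; exact: stein_derivE.
apply: measurable_glue.
- by apply: continuous_measurable_fun; exact: continuous_mulr_mills.
- apply: measurableT_comp => //; apply: continuous_measurable_fun.
  exact: continuous_mulr_millsN.
Qed.

(** The jump of [stein_deriv] is harmless, as both branches of [stein] take the value
    [Phi x * (1 - Phi x) / phi x] at [x]. *)
Lemma stein_average x z y :
  y * \int[@unif01 R]_u stein_deriv x (z + u * y) = stein x (z + y) - stein x z.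
Proof.
apply: (@unif01_average_glue R _ _ (fun z => mills z * (1 - Phi x))
  (fun z => mills (- z) * Phi x) (fun z => (1 - Phi x) * (1 + z * mills z))
  (fun z => - (Phi x * (1 + (- z) * mills (- z)))) x z y 1).
- by move=> t; exact: stein_derivE.
- by [].
- exact: measurable_stein_deriv.
- by move=> u _; exact: stein_deriv_bound.
- exact: continuous_mulr_mills.
- move=> t; apply: cvgN.
  exact: continuous_mulr_millsN.
- move=> t; have d := is_derive_mills t.
  by apply: is_derive_eq; rewrite /GRing.scale/= mulrC; ring.
- move=> t; have d := is_derive1_comp (is_derive_mills (- t)) (is_deriveNid t 1).
  by apply: is_derive_eq; rewrite /GRing.scale/=; ring.
- rewrite /mills Phi_N phiN; ring.
Qed.

End stein_average.

(** Independence of [N] and the later steps is handled by restricting [P] to an event, which leaves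
    a measure of mass [c] rather than 1. The factor is absorbed into the first marginal before
    uniqueness of product measures applies. *)
Lemma scaled_product_unique d1 d2 (T1 : measurableType d1)
    (T2 : measurableType d2) (R : realType) (P1 : probability T1 R)
    (P2 : probability T2 R) (c : {nonneg R})
    (m : {measure set (T1 * T2) -> \bar R}) :
  (forall A1 A2, measurable A1 -> measurable A2 ->
     m (A1 `*` A2) = (c%:num%:E * (P1 A1 * P2 A2))%E) ->
  forall D, measurable D -> m D = (c%:num%:E * (P1 \x P2) D)%E.
Proof.
move=> mE D mD.
rewrite -(@product_measure_unique _ _ _ _ _ (mscale c P1) P2 m)//; last first.
  by move=> A1 A2 mA1 mA2; rewrite mE// /mscale/= muleA.
rewrite (@product_measure_unique _ _ _ _ _ (mscale c P1) P2 (mscale c (P1 \x P2)%E))//.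
move=> A1 A2 mA1 mA2; rewrite /mscale/= -muleA; congr (_ * _)%E.
exact: product_measure1E.
Qed.

(** * Independence of partial sums, and the size-bias identity for compound Poisson sums *)

Section compound_poisson.
Context d (T : measurableType d) {R : realType} (P : probability T R).
Variables (X : nat -> {RV P >-> R}) (N : T -> nat).

Definition partial_sum n w : R := \sum_(i < n) X i w.

Lemma measurable_partial_sum n : measurable_fun setT (partial_sum n).
Proof. by apply: measurable_sum => i; exact: measurable_funPT. Qed.

HB.instance Definition _ n :=
  isMeasurableFun.Build _ _ _ _ (partial_sum n) (measurable_partial_sum n).

Definition partial_sum_law n : probability R R :=
  [the probability R R of distribution P (partial_sum n : {RV P >-> R})].

Definition step_law : probability R R :=
  [the probability R R of distribution P (X 0%N)].

Hypothesis Xid : ident_distr P (fun i => X i).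
Hypothesis NX : indep_count_seq P N (fun i => X i).
Hypothesis mN : forall k, measurable (N @^-1` [set k]).

Lemma measurable_count C : measurable (N @^-1` C).
Proof.
rewrite (_ : N @^-1` C = \bigcup_(k in C) N @^-1` [set k]).
  by apply: bigcup_measurable => k _.
by apply/seteqP; split => [w Cw|w [k Ck Nw]]; [exists (N w)|rewrite /= [N w]Nw].
Qed.

Lemma measurable_step i (B : set R) : measurable B -> measurable (X i @^-1` B).
Proof. by move=> mB; rewrite -[X in measurable X]setTI; exact: measurable_funPT. Qed.

Lemma measurable_partial_sum_preimage n (B : set R) :
  measurable B -> measurable (partial_sum n @^-1` B).
Proof. by move=> mB; rewrite -[X in measurable X]setTI; exact: measurable_partial_sum. Qed.

Lemma step_lawE i B : measurable B -> P (X i @^-1` B) = step_law B.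
Proof. by move=> mB; rewrite Xid. Qed.

Definition sum_step n w : R * R := (partial_sum n w, X n w).

Lemma measurable_sum_step n : measurable_fun setT (sum_step n).
Proof.
by apply: measurable_fun_pair; [exact: measurable_partial_sum|exact: measurable_funPT].
Qed.

(* Extends the product rule of [indep_count_seq] from the steps to the partial sum,
   keeping the later steps so that induction on [n] goes through. *)
Definition joint_independent n := forall k C A (B : nat -> set R),
  measurable A -> (forall i, measurable (B i)) ->
  P (N @^-1` C `&` partial_sum n @^-1` A `&`
     \bigcap_(i in `I_k) (X (n + i)%N @^-1` B i)) =
  (P (N @^-1` C) * partial_sum_law n A * \prod_(i < k) step_law (B i))%E.

(** With the event on [N] and the later steps fixed, the restricted measure pushed forward along
    [sum_step n] is determined by rectangles. This extends the product rule to all measurable [D],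
    in particular to the preimages under addition needed for the next partial sum. *)
Lemma joint_independent_prod n : joint_independent n ->
  forall k C (B : nat -> set R), (forall i, measurable (B i)) ->
  forall D, measurable D ->
  P (sum_step n @^-1` D `&` (N @^-1` C `&`
     \bigcap_(i in `I_k) (X (n.+1 + i)%N @^-1` B i))) =
  (P (N @^-1` C) * \prod_(i < k) step_law (B i) *
   (partial_sum_law n \x step_law) D)%E.
Proof.
move=> Jn k C B mB.
set E := N @^-1` C `&` _.
have mE : measurable E.
  apply: measurableI; first exact: measurable_count.
  by apply: bigcap_measurableType => i _; exact: measurable_step.
have c0 : (0 <= P (N @^-1` C) * \prod_(i < k) step_law (B i))%E.
  by rewrite mule_ge0// prode_ge0.
have cfin : (P (N @^-1` C) * \prod_(i < k) step_law (B i))%E \is a fin_num.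
  rewrite fin_numM ?fin_num_measure//; first exact: measurable_count.
  by apply: prode_fin_num => i _; rewrite fin_num_measure.
pose c : {nonneg R} := NngNum (fine_ge0 c0).
have -> : (P (N @^-1` C) * \prod_(i < k) step_law (B i))%E = c%:num%:E.
  by rewrite /= fineK.
have mpair := measurable_sum_step n.
pose m' := pushforward (mrestr P mE) (sum_step n).
apply: (@scaled_product_unique _ _ _ _ _ _ _ c m').
move=> A1 A2 mA1 mA2; rewrite /= fineK//.
(* A rectangle is the case of [k + 1] later steps, with [A2] put in front as the constraint on the
   first of them. *)
have mB' i : measurable (if i is j.+1 then B j else A2) by case: i.
have := Jn k.+1 C A1 (fun i => if i is j.+1 then B j else A2) mA1 mB'.
rewrite big_ord_recl /= => H.
rewrite /m' /pushforward/= /mrestr.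
transitivity (P (N @^-1` C `&` partial_sum n @^-1` A1
  `&` \bigcap_(i < k.+1) X (n + i)%N @^-1` (if i is j.+1 then B j else A2))).
  congr (P _); apply/seteqP; split => w /=.
  - move=> [[A1w A2w] [Cw Bw]]; split => // -[|i] /= ik; first by rewrite addn0.
    by rewrite addnS -addSn; exact: Bw.
  - move=> [[Cw A1w] Bw]; split; split => //.
    + by have := Bw 0%N erefl; rewrite addn0.
    + by move=> i ik; have := Bw i.+1 ik; rewrite /= addnS -addSn.
by rewrite H -!muleA; congr (_ * _)%E; rewrite [RHS]muleC -muleA.
Qed.

Lemma measurable_add_preimage (A : set R) : measurable A ->
  measurable ((fun p : R * R => p.1 + p.2) @^-1` A).
Proof.
move=> mA; rewrite -[X in measurable X]setTI.
have : measurable_fun setT (fun p : R * R => p.1 + p.2).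
  by apply: measurable_funD; [exact: measurable_fst|exact: measurable_snd].
exact.
Qed.

Lemma partial_sumS n w : partial_sum n.+1 w = partial_sum n w + X n w.
Proof. by rewrite /partial_sum big_ord_recr. Qed.

Lemma joint_independent_pair n : joint_independent n ->
  forall D, measurable D ->
  P (sum_step n @^-1` D) = (partial_sum_law n \x step_law)%E D.
Proof.
move=> Jn D mD.
have := @joint_independent_prod n Jn 0 setT (fun=> setT) (fun=> measurableT) D mD.
rewrite preimage_setT setTI big_ord0 mule1 probability_setT mul1e => <-.
by congr (P _); apply/seteqP; split => w /=; [move=> Dw; split|case].
Qed.

Lemma partial_sum_joint_independent n : joint_independent n.
Proof.
elim: n => [|n Jn] k C A B mA mB.
  have -> : (\prod_(i < k) step_law (B i) = \prod_(i < k) P (X i @^-1` B i))%E.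
    by apply: eq_bigr => i _; rewrite step_lawE.
  rewrite /partial_sum_law/=.
  have E : partial_sum 0 @^-1` A = if 0 \in A then setT else set0.
    by apply/seteqP; split => w; rewrite /= /partial_sum big_ord0; case: ifPn; rewrite ?inE// notin_setE.
  rewrite /distribution /pushforward/= !E; case: ifPn => _.
    rewrite setIT probability_setT mule1 -NX//.
  by rewrite setI0 set0I measure0 mule0 mul0e.
have mA' := measurable_add_preimage mA.
have -> : partial_sum_law n.+1 A =
    (partial_sum_law n \x step_law)%E ((fun p : R * R => p.1 + p.2) @^-1` A).
  rewrite -joint_independent_pair//; congr (P _).
  by apply/seteqP; split => w /=; rewrite partial_sumS.
rewrite muleAC -joint_independent_prod//; congr (P _).
apply/seteqP; split => w /=; rewrite partial_sumS; tauto.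
Qed.

Local Notation law := partial_sum_law.
Local Notation rho := step_law.
Local Notation plus := (fun p : R * R => p.1 + p.2).

Lemma measurable_plus : measurable_fun setT plus.
Proof. by apply: measurable_funD; [exact: measurable_fst|exact: measurable_snd]. Qed.

Lemma partial_sum_lawS n A : measurable A ->
  law n.+1 A = pushforward (law n \x rho)%E plus A.
Proof.
move=> mA; rewrite /pushforward -(joint_independent_pair (@partial_sum_joint_independent n)).
  by congr (P _); apply/seteqP; split => w /=; rewrite partial_sumS.
exact: measurable_add_preimage.
Qed.

Lemma integrable_partial_sumS n (h : R -> R) : measurable_fun setT h ->
  (law n \x rho)%E.-integrable setT (EFin \o (fun p => h (p.1 + p.2))) ->
  (law n.+1).-integrable setT (EFin \o h).
Proof.
move=> mh ih; have mp := measurable_plus.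
have mh' : measurable_fun setT (EFin \o h) by exact/measurable_EFinP.
have := @integrable_pushforward _ _ _ _ R plus mp (law n \x rho)%E setT (EFin \o h) mh'.
rewrite preimage_setT => /(_ ih measurableT) /integrableP[_ hoo].
apply/integrableP; split => //; apply: le_lt_trans hoo.
rewrite le_eqVlt; apply/orP; left; apply/eqP.
by apply: eq_measure_integral => D mD _; exact: partial_sum_lawS.
Qed.

Lemma Rintegral_partial_sumS n (h : R -> R) : measurable_fun setT h ->
  (law n \x rho)%E.-integrable setT (EFin \o (fun p => h (p.1 + p.2))) ->
  \int[law n.+1]_s h s = \int[(law n \x rho)%E]_p h (p.1 + p.2).
Proof.
move=> mh ih; rewrite /Rintegral; congr fine; have mp := measurable_plus.
rewrite (@eq_measure_integral _ _ _ _ (pushforward (law n \x rho)%E plus)).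
  have mh' : measurable_fun setT (EFin \o h) by exact/measurable_EFinP.
  by rewrite integral_pushforward.
by move=> D mD _; exact: partial_sum_lawS.
Qed.

Hypothesis rho_int : rho.-integrable setT (EFin \o id).

Lemma integrable_partial_sum n : (law n).-integrable setT (EFin \o id).
Proof.
elim: n => [|n IH].
  apply: (@integrable_pushforward _ _ _ _ R (partial_sum 0) (measurable_partial_sum 0) P setT).
  - by apply/measurable_EFinP; exact: measurable_id.
  - rewrite preimage_setT; apply: (@bounded_integrable R _ _ P (partial_sum 0) 0).
    + exact: measurable_partial_sum.
    + by move=> w; rewrite /= /partial_sum big_ord0 normr0.
  - by [].
apply: integrable_partial_sumS; first exact: measurable_id.
have i1 := @integrable_prod_fst R _ _ _ _ (law n) rho id IH.
have i2 := @integrable_prod_snd R _ _ _ _ (law n) rho id rho_int.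
by have := integrableD measurableT i1 i2.
Qed.

Lemma Rintegral_partial_sum0 (h : R -> R) : measurable_fun setT h ->
  \int[law 0%N]_s h s = h 0.
Proof.
move=> mh; transitivity (\int[P]_w h (partial_sum 0 w)).
  congr fine; apply: (@integral_pushforward _ _ _ _ R (partial_sum 0) (measurable_partial_sum 0) P setT (EFin \o h)) => //.
  - exact/measurable_EFinP.
  - apply: (@bounded_integrable R _ _ P (h \o partial_sum 0) `|h 0|).
    + exact: (measurableT_comp mh (measurable_partial_sum 0)).
    + by move=> w; rewrite /= /partial_sum big_ord0.
transitivity (\int[P]_w h 0); last exact: Rintegral_cst_prob.
by apply: eq_Rintegral => w _; rewrite /partial_sum big_ord0.
Qed.

(** * Size-bias identity for a fixed number of steps *)

Section bounded_test.
Variables (h : R -> R) (K : R).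
Hypothesis mh : measurable_fun setT h.
Hypothesis hK : forall s, `|h s| <= K.

Definition step_bias s := \int[rho]_x (x * h (s + x)).

Lemma integrable_step_bias s : rho.-integrable setT (EFin \o (fun x => x * h (s + x))).
Proof.
apply: (@integrableM_bounded R _ _ _ id (fun x => h (s + x)) K) => //.
by apply: (measurableT_comp mh); exact: measurable_funD.
Qed.

Lemma integrable_step_bias_prod (mu : probability R R) :
  (mu \x rho)%E.-integrable setT (EFin \o (fun p => p.2 * h (p.1 + p.2))).
Proof.
apply: (@integrableM_bounded R _ _ _ snd (fun p : R * R => h (p.1 + p.2)) K) => //.
- exact: (@integrable_prod_snd R _ _ _ _ mu rho id rho_int).
- exact: (measurableT_comp mh measurable_plus).
Qed.

Lemma measurable_step_bias : measurable_fun setT step_bias.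
Proof. exact: (measurable_Rintegral_snd (integrable_step_bias_prod (law 0))). Qed.

Lemma step_bias_bound s : `|step_bias s| <= K * \int[rho]_x `|x|.
Proof.
apply: (le_trans (le_normr_Rintegral _ (integrable_step_bias s))) => //.
have ia := integrable_normr rho_int.
rewrite -RintegralZl//; apply: le_Rintegral => //.
- exact/integrable_normr/integrable_step_bias.
- by have := integrableZl measurableT K ia; apply: eq_integrable.
- by move=> x _; rewrite normrM mulrC ler_wpM2r.
Qed.

Lemma Rintegral_step_bias (mu : probability R R) :
  \int[mu]_s step_bias s = \int[(mu \x rho)%E]_p (p.2 * h (p.1 + p.2)).
Proof.
by apply: Rintegral_prod12; [exact: integrable_step_bias_prod|exact: integrable_step_bias].
Qed.

End bounded_test.

(* The last step is split off and the others are treated by induction, with [h]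
   shifted by the last step; this replaces an appeal to exchangeability. *)
Lemma size_bias_partial_sum n (h : R -> R) (K : R) : measurable_fun setT h ->
  (forall s, `|h s| <= K) ->
  \int[law n.+1]_s (s * h s) = n.+1%:R * \int[law n]_s step_bias h s.
Proof.
elim: n h => [|n IH] h mh hK.
all: have mhp := measurableT_comp mh measurable_plus.
all: have mshift (x : R) : measurable_fun setT (fun s : R => h (s + x)) by
  apply: (measurableT_comp mh); exact: measurable_funD.
all: have mF : measurable_fun setT (fun s : R => s * h s) by exact: measurable_funM.
- have i1 := @integrable_prod_fst R _ _ _ _ (law 0) rho id (integrable_partial_sum 0).
  have i1' := integrableM_bounded i1 mhp (fun p => hK _).
  have i2' := integrable_step_bias_prod mh hK (law 0).
  have E : \int[(law 0 \x rho)%E]_p (p.1 * h (p.1 + p.2)) = 0.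
    rewrite -Rintegral_prod21//=.
    + rewrite -[RHS](Rintegral_cst_prob rho); apply: eq_Rintegral => x _.
      rewrite (@Rintegral_partial_sum0 (fun s : R => s * h (s + x))) ?mul0r//.
      exact: measurable_funM.
    + move=> x; apply: (@integrableM_bounded R _ _ _ id (fun s : R => h (s + x)) K) => //.
      exact: integrable_partial_sum.
  rewrite (Rintegral_partial_sumS mF).
    rewrite mul1r (Rintegral_step_bias mh hK) -[RHS]add0r -E -RintegralD//.
    by apply: eq_Rintegral => p _; rewrite mulrDl.
  have := integrableD measurableT i1' i2'; apply: eq_integrable => // p _.
  by rewrite /= mulrDl.
- have i1 := @integrable_prod_fst R _ _ _ _ (law n.+1) rho id (integrable_partial_sum n.+1).
  have i1' := integrableM_bounded i1 mhp (fun p => hK _).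
  have i2' := integrable_step_bias_prod mh hK (law n.+1).
  have mk := measurable_step_bias mh hK.
  have kK := step_bias_bound mh hK.
  have ik (mu : probability R R) : mu.-integrable setT (EFin \o (step_bias h)).
    exact: bounded_integrable mk kK.
  have ikp : (law n \x rho)%E.-integrable setT (EFin \o (fun p => step_bias h (p.1 + p.2))).
    apply: (@bounded_integrable R _ _ (law n \x rho)%E _ (K * \int[rho]_x `|x|)) => //.
    exact: (measurableT_comp mk measurable_plus).
  (* The induction hypothesis for the shifted [h] yields [step_bias h] at [s + x]; averaging over
     [x] turns [law n] back into [law n.+1]. *)
  have E : \int[(law n.+1 \x rho)%E]_p (p.1 * h (p.1 + p.2)) =
      n.+1%:R * \int[law n.+1]_s step_bias h s.
    rewrite -Rintegral_prod21//=.
    + rewrite (Rintegral_partial_sumS mk ikp) -(Rintegral_prod21 ikp) => [|x] /=; last first.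
        apply: (@bounded_integrable R _ _ (law n) _ (K * \int[rho]_x `|x|)) => //.
        by apply: (measurableT_comp mk); exact: measurable_funD.
      rewrite -RintegralZl//=; last first.
        apply: (@bounded_integrable R _ _ rho _ (K * \int[rho]_x `|x|)).
          exact: measurable_Rintegral_fst ikp.
        move=> x; apply: Rintegral_norm_bound; last by move=> s; exact: kK.
        apply: (@bounded_integrable R _ _ (law n) _ (K * \int[rho]_x `|x|)) => //.
        by apply: (measurableT_comp mk); exact: measurable_funD.
      apply: eq_Rintegral => x _; rewrite (IH (fun s : R => h (s + x)))//; congr (_ * _).
      apply: eq_Rintegral => s _; apply: eq_Rintegral => y _.
      by rewrite addrAC.
    + move=> x; apply: (@integrableM_bounded R _ _ _ id (fun s : R => h (s + x)) K) => //.
      exact: integrable_partial_sum.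
  rewrite (Rintegral_partial_sumS mF).
    rewrite -[n.+2%:R]natr1 mulrDl mul1r -E (Rintegral_step_bias mh hK) -RintegralD//.
    by apply: eq_Rintegral => p _; rewrite mulrDl.
  have := integrableD measurableT i1' i2'; apply: eq_integrable => // p _.
  by rewrite /= mulrDl.
Qed.

(** * Passage from partial sums to a Poisson number of steps *)

Variable lambda : R.
Hypothesis lambda0 : 0 < lambda.
Hypothesis Npoisson : forall k, P (N @^-1` [set k]) = (poisson_pmf lambda k)%:E.
Local Notation p := (poisson_pmf lambda).

Definition compound_sum w := partial_sum (N w) w.

Lemma compound_sum_preimage A : compound_sum @^-1` A =
  \bigcup_k (N @^-1` [set k] `&` partial_sum k @^-1` A).
Proof.
apply/seteqP; split => [w Aw|w [k _] [/= <-]]; last by [].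
by exists (N w).
Qed.

Lemma measurable_compound_piece k A : measurable A ->
  measurable (N @^-1` [set k] `&` partial_sum k @^-1` A).
Proof. by move=> mA; apply: measurableI => //; exact: measurable_partial_sum_preimage. Qed.

Lemma measurable_compound_sum : measurable_fun setT compound_sum.
Proof.
move=> _ A mA; rewrite setTI compound_sum_preimage.
by apply: bigcup_measurable => k _; exact: measurable_compound_piece.
Qed.

HB.instance Definition _ :=
  isMeasurableFun.Build _ _ _ _ compound_sum measurable_compound_sum.

Definition compound_law : probability R R :=
  [the probability R R of distribution P (compound_sum : {RV P >-> R})].

(** The compound law as a series of scaled measures, so that integrals of nonnegative functions
    split term by term. *)
Let mix : {measure set R -> \bar R} :=
  [the {measure set R -> \bar R} of mseries (fun k => [the {measure set R -> \bar R} of mscale (NngNum (poisson_pmf_ge0 lambda k)) (law k)]) 0].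

Lemma compound_law_mix A : measurable A -> compound_law A = mix A.
Proof.
move=> mA; rewrite /compound_law /mix /= /distribution /pushforward compound_sum_preimage.
rewrite /mseries measure_semi_bigcup//=; last 3 first.
  by move=> k; exact: measurable_compound_piece.
  apply/trivIsetP => i j _ _ ij; apply/seteqP; split => // w [[/= Ni _] [/= Nj _]].
  by move/eqP: ij; apply; rewrite -Ni -Nj.
  by apply: bigcup_measurable => k _; exact: measurable_compound_piece.
apply: eq_eseriesr => k _ /=.
have := @partial_sum_joint_independent k 0 [set k] A (fun=> setT) mA (fun=> measurableT).
rewrite big_ord0 mule1 Npoisson /mscale/= => <-; congr (P _).
by apply/seteqP; split => w /=; [move=> ?; split|case].
Qed.

Lemma integral_compound_law (h : R -> R) : measurable_fun setT h ->
  (forall s, 0 <= h s) ->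
  (\int[compound_law]_s (h s)%:E =
   \sum_(k <oo) (p k)%:E * \int[law k]_s (h s)%:E)%E.
Proof.
move=> mh h0; have mh' : measurable_fun setT (EFin \o h) by exact/measurable_EFinP.
rewrite (@eq_measure_integral _ _ _ _ mix); last first.
  by move=> A mA _; exact: compound_law_mix.
have h0' t : setT t -> (0 <= (h t)%:E)%E by rewrite lee_fin.
rewrite /mix ge0_integral_measure_series//=.
apply: eq_eseriesr => k _ /=.
by rewrite ge0_integral_mscale.
Qed.

Lemma poisson_pmfS k : p k.+1 * k.+1%:R = lambda * p k.
Proof.
rewrite /poisson_pmf lambda0 factS natrM exprS; field.
by rewrite nat1r !pnatr_eq0 -lt0n fact_gt0.
Qed.

(** The total mass is read off from [compound_law] being a probability, without summing the
    exponential series. *)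
Lemma sum_poisson_le1 n : \sum_(k < n) p k <= 1.
Proof.
have E1 (mu : probability R R) : (\int[mu]_s 1%:E = 1 :> \bar R)%E.
  by rewrite integral_cst// mul1e; exact: probability_setT.
have := @integral_compound_law (fun=> 1) (measurable_cst _) (fun=> ler01).
have -> : (\sum_(k <oo) (p k)%:E * \int[law k]_s 1%:E = \sum_(k <oo) (p k)%:E)%E.
  by apply: eq_eseriesr => k _; rewrite E1 mule1.
rewrite E1 => E; rewrite -lee_fin E; rewrite -sumEFin.
rewrite -(big_mkord xpredT (fun k => (p k)%:E)).
by apply: nneseries_lim_ge => k _ _; rewrite lee_fin poisson_pmf_ge0.
Qed.

Lemma Rintegral_norm_partial_sum n :
  \int[law n]_s `|s| <= n%:R * \int[rho]_x `|x|.
Proof.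
elim: n => [|n IH].
  by rewrite Rintegral_partial_sum0 ?normr0 ?mul0r//; exact: normr_measurable.
have mn : measurable_fun setT (fun x : R => `|x|) by exact: normr_measurable.
have i1 := @integrable_prod_fst R _ _ _ _ (law n) rho _ (integrable_normr (integrable_partial_sum n)).
have i2 := @integrable_prod_snd R _ _ _ _ (law n) rho _ (integrable_normr rho_int).
have i3 : (law n \x rho)%E.-integrable setT (EFin \o (fun p => `|p.1| + `|p.2|)).
  by have := integrableD measurableT i1 i2; apply: eq_integrable.
have i4 : (law n \x rho)%E.-integrable setT (EFin \o (fun p => `|p.1 + p.2|)).
  apply: dominated_integrable_real i3 _ => //.
    exact: (measurableT_comp mn measurable_plus).
  by move=> q; rewrite normr_id ler_normD.
rewrite Rintegral_partial_sumS//.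
apply: (@le_trans _ _ (\int[(law n \x rho)%E]_p (`|p.1| + `|p.2|))).
  by apply: le_Rintegral => // q _; exact: ler_normD.
rewrite RintegralD//= -[n.+1%:R]natr1 mulrDl mul1r lerD//.
- rewrite -(Rintegral_prod12 i1); last first.
    by move=> x; apply: (@bounded_integrable R _ _ rho (cst `|x|) `|x|) => //= _; rewrite normr_id.
  apply: le_trans IH; rewrite le_eqVlt; apply/orP; left; apply/eqP.
  by apply: eq_Rintegral => x _; exact: (Rintegral_cst_prob rho `|x|).
- rewrite -(Rintegral_prod21 i2); last first.
    by move=> x; apply: (@bounded_integrable R _ _ (law n) (cst `|x|) `|x|) => //= _; rewrite normr_id.
  rewrite le_eqVlt; apply/orP; left; apply/eqP.
  by apply: eq_Rintegral => x _; exact: (Rintegral_cst_prob (law n) `|x|).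
Qed.

(** By [poisson_pmfS] the sum of [k * p k] is at most [lambda], and the [k]-th partial sum has
    absolute mean at most [k * c]; hence the bound [lambda * c]. *)
Lemma integrable_compound_law : compound_law.-integrable setT (EFin \o id).
Proof.
apply/integrableP; split; first by apply/measurable_EFinP; exact: measurable_id.
have -> : (\int[compound_law]_x `|(EFin \o id) x| = \int[compound_law]_x (`|x|)%:E)%E by [].
rewrite integral_compound_law//.
pose c := \int[rho]_x `|x|.
have c0 : 0 <= c by apply: Rintegral_ge0 => x _.
apply: (@le_lt_trans _ _ (lambda * c)%:E); last by rewrite ltry.
have E k : (\int[law k]_s (`|s|)%:E = (\int[law k]_s `|s|)%:E)%E.
  rewrite /Rintegral fineK//.
  exact: (integrable_fin_num measurableT (integrable_normr (integrable_partial_sum k))).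
apply: lime_le.
  apply: is_cvg_nneseries => k _ _; rewrite E -EFinM lee_fin mulr_ge0 ?poisson_pmf_ge0//.
  exact: Rintegral_ge0.
apply: nearW => n; rewrite big_mkord.
rewrite (eq_bigr (fun k : 'I_n => (p k * \int[law k]_s `|s|)%:E)) => [|k _]; last first.
  by rewrite E.
rewrite sumEFin lee_fin.
apply: (@le_trans _ _ (\sum_(k < n) p k * (k%:R * c))).
  by apply: ler_sum => k _; rewrite ler_wpM2l ?poisson_pmf_ge0// Rintegral_norm_partial_sum.
case: n => [|n]; first by rewrite big_ord0 mulr_ge0// ltW.
rewrite big_ord_recl mul0r mulr0 add0r.
rewrite (eq_bigr (fun k : 'I_n => lambda * c * p k)) => [|k _]; last first.
  by rewrite mulrA poisson_pmfS /=; ring.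
rewrite -mulr_sumr -[leRHS]mulr1 ler_wpM2l ?sum_poisson_le1//.
by rewrite mulr_ge0// ltW.
Qed.

Lemma cvg_compound_law_ge0 (h : R -> R) : measurable_fun setT h ->
  (forall s, 0 <= h s) -> compound_law.-integrable setT (EFin \o h) ->
  (forall k, (law k).-integrable setT (EFin \o h)) ->
  (fun n => \sum_(k < n) p k * \int[law k]_s h s) @ \oo --> \int[compound_law]_s h s.
Proof.
move=> mh h0 ih ihk.
have E k : (\int[law k]_s (h s)%:E = (\int[law k]_s h s)%:E)%E.
  by rewrite /Rintegral fineK//; exact: (integrable_fin_num measurableT (ihk k)).
have C : cvgn (fun n => \sum_(0 <= k < n) (p k)%:E * \int[law k]_s (h s)%:E)%E.
  apply: is_cvg_nneseries => k _ _; rewrite E -EFinM lee_fin mulr_ge0 ?poisson_pmf_ge0//.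
  exact: Rintegral_ge0.
have : (\sum_(0 <= k < n) (p k)%:E * \int[law k]_s (h s)%:E)%E @[n --> \oo] -->
    (\int[compound_law]_s (h s)%:E)%E.
  by rewrite (integral_compound_law mh h0); exact: C.
have -> : (\int[compound_law]_s (h s)%:E = (\int[compound_law]_s h s)%:E)%E.
  by rewrite /Rintegral fineK//; exact: (integrable_fin_num measurableT ih).
move=> /fine_cvg; apply: cvg_trans; apply: near_eq_cvg; apply: nearW => n /=.
rewrite big_mkord (eq_bigr (fun k : 'I_n => (p k * \int[law k]_s h s)%:E)) => [|k _].
  by rewrite sumEFin.
by rewrite E.
Qed.

(** The decomposition [h = (|h| + h) - |h|] reduces this to nonnegative functions. *)
Lemma cvg_compound_law (h : R -> R) : measurable_fun setT h ->
  compound_law.-integrable setT (EFin \o h) ->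
  (forall k, (law k).-integrable setT (EFin \o h)) ->
  (fun n => \sum_(k < n) p k * \int[law k]_s h s) @ \oo --> \int[compound_law]_s h s.
Proof.
move=> mh ih ihk.
have isum (mu : probability R R) : mu.-integrable setT (EFin \o h) ->
    mu.-integrable setT (EFin \o (fun x : R => `|h x| + h x)).
  by move=> i; have := integrableD measurableT (integrable_normr i) i; apply: eq_integrable.
have ma : measurable_fun setT (fun x : R => `|h x|) by exact: measurableT_comp.
have E (mu : probability R R) : mu.-integrable setT (EFin \o h) ->
    \int[mu]_s h s = \int[mu]_s (`|h s| + h s) - \int[mu]_s `|h s|.
  by move=> i; rewrite RintegralD ?integrable_normr// addrAC subrr add0r.
have C1 := @cvg_compound_law_ge0 (fun x => `|h x|) ma (fun=> normr_ge0 _)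
  (integrable_normr ih) (fun k => integrable_normr (ihk k)).
have C2 := @cvg_compound_law_ge0 (fun x => `|h x| + h x) (measurable_funD ma mh) _
  (isum _ ih) (fun k => isum _ (ihk k)).
rewrite E//.
have -> : (fun n => \sum_(k < n) p k * \int[law k]_s h s) =
  (fun n => \sum_(k < n) p k * \int[law k]_s (`|h s| + h s) - \sum_(k < n) p k * \int[law k]_s `|h s|).
  apply/funext => n; rewrite -sumrB; apply: eq_bigr => k _.
  by rewrite E// mulrBr.
apply: cvgB => //; apply: C2 => s.
by have := ler_norm (- h s); rewrite normrN; lra.
Qed.

(** In the mixture, [p k.+1 * k.+1 = lambda * p k] turns the factor from [size_bias_partial_sum]
    into [lambda] and shifts the index by one; the term of index 0 vanishes because the empty sum is
    0. *)
Lemma size_bias_compound_law (h : R -> R) (K : R) : measurable_fun setT h ->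
  (forall s, `|h s| <= K) ->
  \int[compound_law]_s (s * h s) = lambda * \int[compound_law]_s step_bias h s.
Proof.
move=> mh hK.
have mF : measurable_fun setT (fun s : R => s * h s) by exact: measurable_funM.
have iF (mu : probability R R) : mu.-integrable setT (EFin \o id) ->
    mu.-integrable setT (EFin \o (fun s : R => s * h s)).
  by move=> i; exact: (@integrableM_bounded R _ _ _ id h K).
have mk := measurable_step_bias mh hK.
have ik (mu : probability R R) : mu.-integrable setT (EFin \o (step_bias h)).
  exact: bounded_integrable mk (step_bias_bound mh hK).
have C1 := cvg_compound_law mF (iF _ integrable_compound_law)
  (fun k => iF _ (integrable_partial_sum k)).
have C2 := cvg_compound_law mk (ik compound_law) (fun k => ik (law k)).
have C3 : lambda * (\sum_(k < n) p k * \int[law k]_s step_bias h s) @[n --> \oo] -->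
    lambda * \int[compound_law]_s step_bias h s.
  by apply: cvgM => //; exact: cvg_cst.
move: C1; rewrite -cvg_shiftS => C1.
apply: (cvg_unique _ C1) => //.
move: C3; apply: cvg_trans; apply: near_eq_cvg; apply: nearW => n /=.
rewrite big_ord_recl (@Rintegral_partial_sum0 (fun s => s * h s))// mul0r mulr0 add0r.
rewrite mulr_sumr; apply: eq_bigr => k _.
by rewrite (size_bias_partial_sum _ mh hK) !mulrA poisson_pmfS.
Qed.

End compound_poisson.

(** * Zero bias and Stein's method; the Poisson structure enters only through [zeta_bias] *)

Section zero_bias.
Context {R : realType}.
Variables (rho zeta : probability R R) (lambda : R).
Local Notation U := (@unif01 R).
Implicit Types (G H W f : R -> R) (a s t u x y z K : R).

Hypothesis lambda0 : 0 < lambda.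
Hypothesis rho_int : rho.-integrable setT (EFin \o id).
Hypothesis rho_sq : rho.-integrable setT (EFin \o (fun x : R => x ^+ 2)).
Hypothesis rho_mean : \int[rho]_x x = 0.
Hypothesis rho_var : lambda * \int[rho]_x (x ^+ 2) = 1.
Hypothesis zeta_int : zeta.-integrable setT (EFin \o id).
Hypothesis zeta_bias : forall f K, measurable_fun setT f -> (forall s, `|f s| <= K) ->
  \int[zeta]_s (s * f s) = lambda * \int[zeta]_s \int[rho]_x (x * f (s + x)).

Definition bounded_mfun G := measurable_fun setT G /\ exists K, forall t, `|G t| <= K.

Lemma bounded_mfun_cst K : bounded_mfun (fun=> K).
Proof. by split => //; exists `|K|. Qed.

Lemma bounded_mfunD G H : bounded_mfun G -> bounded_mfun H -> bounded_mfun (fun t => G t + H t).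
Proof.
move=> [mG [K1 G1]] [mH [K2 H1]]; split; first exact: measurable_funD.
by exists (K1 + K2) => t; rewrite (le_trans (ler_normD _ _))// lerD.
Qed.

Lemma bounded_mfunM G H : bounded_mfun G -> bounded_mfun H -> bounded_mfun (fun t => G t * H t).
Proof.
move=> [mG [K1 G1]] [mH [K2 H1]]; split; first exact: measurable_funM.
by exists (K1 * K2) => t; rewrite normrM ler_pM.
Qed.

Lemma bounded_mfunZ K G : bounded_mfun G -> bounded_mfun (fun t => K * G t).
Proof. exact/bounded_mfunM/bounded_mfun_cst. Qed.

Lemma bounded_mfunB G H : bounded_mfun G -> bounded_mfun H -> bounded_mfun (fun t => G t - H t).
Proof.
move=> bG bH; have := bounded_mfunD bG (bounded_mfunZ (-1) bH).
by congr bounded_mfun; apply/funext => t; rewrite mulN1r.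
Qed.

Lemma bounded_mfun_comp G f : bounded_mfun G -> measurable_fun setT f -> bounded_mfun (fun t => G (f t)).
Proof.
move=> [mG [K GK]] mf; split; first exact: (measurableT_comp mG mf).
by exists K => t.
Qed.

Lemma bounded_mfun_ltr x : bounded_mfun (fun t => (t < x)%R%:R).
Proof.
split; last by exists 1 => t; case: ltP; rewrite ?normr1 ?normr0.
by apply: nonincreasing_measurable => // s t st; case: (ltP t x) => tx; case: ltP => sx //; lra.
Qed.

Lemma bounded_mfun_ler x : bounded_mfun (fun t => (x <= t)%R%:R).
Proof.
split; last by exists 1 => t; case: (leP x t); rewrite ?normr1 ?normr0.
by apply: nondecreasing_measurable => // s t st; case: (leP x s) => tx; case: (leP x t) => sx //=; lra.
Qed.

(* [bias (fun=> 1) G] is the mean of [G (V)], where [Z + V] has the zero-biased law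
   of [Z]; the weight [W] allows restricting to small or large jumps. *)
Definition bias W G :=
  lambda * \int[(rho \x U)%E]_p (p.1 ^+ 2 * (W p.1 * G (p.2 * p.1))).

Definition weight W := lambda * \int[rho]_x (x ^+ 2 * W x).

Lemma measurable_scale : measurable_fun setT (fun p : R * R => p.2 * p.1).
Proof. by apply: measurable_funM; [exact: measurable_snd|exact: measurable_fst]. Qed.

Lemma bias_integrable W G : bounded_mfun W -> bounded_mfun G ->
  (rho \x U)%E.-integrable setT (EFin \o (fun p => p.1 ^+ 2 * (W p.1 * G (p.2 * p.1)))).
Proof.
move=> [mW [K1 W1]] [mG [K2 G1]].
apply: (@integrableM_bounded R _ _ _ (fun p : R * R => p.1 ^+ 2)
  (fun p : R * R => W p.1 * G (p.2 * p.1)) (K1 * K2)).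
- exact: (@integrable_prod_fst R _ _ _ _ rho U _ rho_sq).
- apply: measurable_funM; first exact: (measurableT_comp mW measurable_fst).
  exact: (measurableT_comp mG measurable_scale).
- by move=> p; rewrite normrM ler_pM.
Qed.

Lemma biasD W G H : bounded_mfun W -> bounded_mfun G -> bounded_mfun H ->
  bias W (fun t => G t + H t) = bias W G + bias W H.
Proof.
move=> bW bG bH; rewrite /bias -mulrDr -RintegralD//; [|exact: bias_integrable..].
by congr (_ * _); apply: eq_Rintegral => p _; rewrite -!mulrDr.
Qed.

Lemma biasZ W K G : bounded_mfun W -> bounded_mfun G -> bias W (fun t => K * G t) = K * bias W G.
Proof.
move=> bW bG; rewrite /bias mulrCA -[K * _]RintegralZl//; last exact: (bias_integrable bW bG).
by congr (_ * _); apply: eq_Rintegral => p _; ring.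
Qed.

Lemma biasB W G H : bounded_mfun W -> bounded_mfun G -> bounded_mfun H ->
  bias W (fun t => G t - H t) = bias W G - bias W H.
Proof.
move=> bW bG bH; rewrite -[bias W H]mul1r -mulNr -biasZ// -biasD//; last exact: bounded_mfunZ.
by congr bias; apply/funext => t; rewrite mulN1r.
Qed.

Lemma le_bias W G H : bounded_mfun W -> bounded_mfun G -> bounded_mfun H -> (forall x, 0 <= W x) ->
  (forall t, G t <= H t) -> bias W G <= bias W H.
Proof.
move=> bW bG bH W0 GH; rewrite ler_wpM2l ?(ltW lambda0)//.
apply: le_Rintegral; [by []|exact: bias_integrable..|move=> p _].
by rewrite ler_wpM2l ?sqr_ge0// ler_wpM2l.
Qed.

Lemma bias_splitW W1 W2 G : bounded_mfun W1 -> bounded_mfun W2 -> bounded_mfun G ->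
  bias (fun x => W1 x + W2 x) G = bias W1 G + bias W2 G.
Proof.
move=> b1 b2 bG; rewrite /bias -mulrDr -RintegralD//; [|exact: bias_integrable..].
by congr (_ * _); apply: eq_Rintegral => p _; rewrite mulrDl mulrDr.
Qed.

Lemma weight_integrable W : bounded_mfun W ->
  rho.-integrable setT (EFin \o (fun x => x ^+ 2 * W x)).
Proof. by move=> [mW [K WK]]; exact: (@integrableM_bounded R _ _ _ _ W K). Qed.

Lemma bounded_mfun_section G x : bounded_mfun G -> bounded_mfun (fun u => G (u * x)).
Proof. by move=> bG; apply: bounded_mfun_comp => //; exact: measurable_funM. Qed.

Lemma bounded_mfun_integrable (mu : probability R R) G : bounded_mfun G -> mu.-integrable setT (EFin \o G).
Proof. by move=> [mG [K GK]]; exact: bounded_integrable mG GK. Qed.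

Lemma biasE W G : bounded_mfun W -> bounded_mfun G ->
  bias W G = lambda * \int[rho]_x (x ^+ 2 * (W x * \int[U]_u G (u * x))).
Proof.
move=> bW bG; rewrite /bias; congr (_ * _).
rewrite -Rintegral_prod12/=.
- apply: eq_Rintegral => x _; rewrite mulrA -RintegralZl//; last first.
    exact: (bounded_mfun_integrable U (bounded_mfun_section x bG)).
  by apply: eq_Rintegral => u _; rewrite mulrA.
- exact: bias_integrable.
- move=> x; apply: (bounded_mfun_integrable U); apply: bounded_mfunZ; apply: bounded_mfunZ; exact: bounded_mfun_section.
Qed.

Lemma bias_cst W K : bounded_mfun W -> bias W (fun=> K) = K * weight W.
Proof.
move=> bW; rewrite biasE//; last exact: bounded_mfun_cst.
rewrite /weight mulrCA -[K * _]RintegralZl//; last exact: (weight_integrable bW).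
congr (_ * _); apply: eq_Rintegral => x _; rewrite (Rintegral_cst_prob U); ring.
Qed.

Lemma weight1 : weight (fun=> 1) = 1.
Proof. by rewrite -[RHS]rho_var; congr (_ * _); apply: eq_Rintegral => x _; rewrite mulr1. Qed.

Definition shift_mean (b : R -> R) t := \int[zeta]_s b (s + t).

Lemma bounded_mfun_shift_mean (b : R -> R) : bounded_mfun b -> bounded_mfun (shift_mean b).
Proof.
move=> bb; have [mb [K bK]] := bb; split.
  have ib : (zeta \x rho)%E.-integrable setT (EFin \o (fun p => b (p.1 + p.2))).
    apply: (@bounded_integrable R _ _ (zeta \x rho)%E _ K) => //.
    by apply: (measurableT_comp mb); apply: measurable_funD; [exact: measurable_fst|exact: measurable_snd].
  exact: (measurable_Rintegral_fst ib).
exists K => t; apply: Rintegral_norm_bound => //.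
by apply: (bounded_mfun_integrable zeta); apply: bounded_mfun_comp => //; exact: measurable_funD.
Qed.

(** Since [rho] has mean 0, [x * f (s + x)] may be replaced by [x * (f (s + x) - f s)], which is
    [x ^+ 2] times a uniform average of [b]. The relation between [f] and [b] is asked only in
    averaged form, so [b] may jump. *)
Lemma zero_bias f (b : R -> R) : bounded_mfun f -> bounded_mfun b ->
  (forall z y, y * \int[U]_u b (z + u * y) = f (z + y) - f z) ->
  \int[zeta]_s (s * f s) = bias (fun=> 1) (shift_mean b).
Proof.
move=> bf bb fb; have [mf [Kf fK]] := bf; have [mb [Kb bK]] := bb.
rewrite (zeta_bias mf fK) /bias; congr (_ * _).
have mq : measurable_fun setT (fun q : R * (R * R) => q.1 + q.2.2 * q.2.1).
  apply: measurable_funD; first exact: measurable_fst.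
  apply: measurable_funM.
    by apply: (measurableT_comp measurable_snd); exact: measurable_snd.
  by apply: (measurableT_comp measurable_fst); exact: measurable_snd.
have iq : (zeta \x (rho \x U))%E.-integrable setT
    (EFin \o (fun q => q.2.1 ^+ 2 * b (q.1 + q.2.2 * q.2.1))).
  have i1 := @integrable_prod_fst R _ _ _ _ rho U _ rho_sq.
  have i2 := @integrable_prod_snd R _ _ _ _ zeta (rho \x U)%E (fun p => p.1 ^+ 2) i1.
  have mbq := measurableT_comp mb mq.
  exact: (integrableM_bounded i2 mbq (fun q => bK _)).
have sec s : (rho \x U)%E.-integrable setT (EFin \o (fun p : R * R => p.1 ^+ 2 * b (s + p.2 * p.1))).
  apply: (@integrableM_bounded R _ _ _ (fun p : R * R => p.1 ^+ 2)
    (fun p : R * R => b (s + p.2 * p.1)) Kb) => //.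
    exact: (@integrable_prod_fst R _ _ _ _ rho U _ rho_sq).
  apply: (measurableT_comp mb); apply: measurable_funD => //; exact: measurable_scale.
transitivity (\int[zeta]_s \int[(rho \x U)%E]_p (p.1 ^+ 2 * b (s + p.2 * p.1))).
  apply: eq_Rintegral => s _; rewrite -Rintegral_prod12//=; last first.
    move=> x; apply: (bounded_mfun_integrable U); apply: bounded_mfunZ; apply: bounded_mfun_comp => //.
    by apply: measurable_funD => //; exact: measurable_funM.
  have i1 : rho.-integrable setT (EFin \o (fun x => x * f (s + x))).
    apply: (@integrableM_bounded R _ _ _ id (fun x => f (s + x)) Kf) => //.
    by apply: (measurableT_comp mf); exact: measurable_funD.
  have i2 : rho.-integrable setT (EFin \o (fun x => f s * x)).
    by have := integrableZl measurableT (f s) rho_int; apply: eq_integrable.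
  rewrite -[LHS]subr0 -(mulr0 (f s)) -rho_mean -RintegralZl// -RintegralB//.
  apply: eq_Rintegral => x _; rewrite [f s * x]mulrC -mulrBr -fb mulrA -expr2.
  rewrite -RintegralZl//.
  apply: (bounded_mfun_integrable U); apply: bounded_mfun_comp => //.
  by apply: measurable_funD => //; exact: measurable_funM.
rewrite (Rintegral_prod12 iq sec) -(Rintegral_prod21 iq)/=; last first.
  move=> p; apply: (bounded_mfun_integrable zeta); apply: bounded_mfunZ; apply: bounded_mfun_comp => //.
  exact: measurable_funD.
apply: eq_Rintegral => p _; rewrite mul1r /shift_mean RintegralZl//.
by apply: (bounded_mfun_integrable zeta); apply: bounded_mfun_comp => //; exact: measurable_funD.
Qed.

Definition strict_cdf x := \int[zeta]_s (s < x)%R%:R.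
Local Notation F := strict_cdf.

Lemma strict_cdf_monotone x y : x <= y -> F x <= F y.
Proof.
move=> xy; apply: le_Rintegral => //; [exact: (bounded_mfun_integrable zeta (bounded_mfun_ltr _))..|].
move=> s _; case: (ltP s x) => sx; case: (ltP s y) => sy //=.
by move: (lt_le_trans sx xy); rewrite ltNge sy.
Qed.

Lemma strict_cdf_ge0 x : 0 <= F x.
Proof. by apply: Rintegral_ge0 => s _; exact: ler0n. Qed.

Lemma strict_cdf_le1 x : F x <= 1.
Proof.
apply: Rintegral_le_bound; first exact: (bounded_mfun_integrable zeta (bounded_mfun_ltr _)).
by move=> s; case: ltP.
Qed.

Lemma bounded_mfun_cdf : bounded_mfun F.
Proof.
split; first by apply: nondecreasing_measurable => // x y; exact: strict_cdf_monotone.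
by exists 1 => x; rewrite ger0_norm ?strict_cdf_le1// strict_cdf_ge0.
Qed.

Lemma bounded_mfun_cdfB x : bounded_mfun (fun t => F (x - t)).
Proof. by apply: bounded_mfun_comp => //; [exact: bounded_mfun_cdf|exact: measurable_funB]. Qed.

Lemma bounded_mfun1 : bounded_mfun (fun=> 1).
Proof. exact: bounded_mfun_cst. Qed.

(** * Clamped test functions and the density bound for the zero-biased law *)

Definition ramp a z := Num.max (z - a) 0.

Lemma rampE a z : ramp a z = if z < a then 0 else z - a.
Proof.
rewrite /ramp; case: ltP => za.
- by apply/max_idPr; rewrite subr_le0 ltW.
- by apply/max_idPl; rewrite subr_ge0.
Qed.

Lemma measurable_ramp a : measurable_fun setT (ramp a).
Proof.
apply: nondecreasing_measurable => // s t st.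
by rewrite !rampE; case: (ltP s a) => sa; case: (ltP t a) => ta; lra.
Qed.

Lemma ramp_average a z y :
  y * \int[U]_u (a <= z + u * y)%R%:R = ramp a (z + y) - ramp a z.
Proof.
have E t : (a <= t)%R%:R = if t < a then 0 else 1 :> R by case: ltP.
apply: (@unif01_average_glue R (fun t => (a <= t)%R%:R) (ramp a) (fun=> 0)
  (fun t => t - a) (fun=> 0) (fun=> 1) a z y 1).
- exact: E.
- exact: rampE.
- by have [] := bounded_mfun_ler a.
- by move=> u _; case: (leP a (z + u * y)); rewrite ?normr1 ?normr0.
- by move=> t; exact: cvg_cst.
- by move=> t; exact: cvg_cst.
- by move=> t; apply: is_derive_eq; rewrite subr0.
- by rewrite subrr.
Qed.

(** A primitive of the indicator of [[a, b)], centred so that its sup norm is [(b - a) / 2]; this is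
    the origin of the density bound 1/2. *)
Definition clamp a (b : R) z := ramp a z - ramp b z - (b - a) / 2.

Lemma clamp_bound a (b : R) z : a <= b -> `|clamp a b z| <= (b - a) / 2.
Proof.
move=> ab; rewrite /clamp !rampE ler_norml.
by case: (ltP z a) => za; case: (ltP z b) => zb; lra.
Qed.

Lemma bounded_mfun_clamp a (b : R) : a <= b -> bounded_mfun (clamp a b).
Proof.
move=> ab; split; last by exists ((b - a) / 2) => z; exact: clamp_bound.
apply: measurable_funB => //.
by apply: measurable_funB; exact: measurable_ramp.
Qed.

Lemma clamp_bias a (b : R) : a <= b ->
  \int[zeta]_s (s * clamp a b s) =
  bias (fun=> 1) (shift_mean (fun s => (a <= s)%R%:R - (b <= s)%R%:R)).
Proof.
move=> ab; apply: zero_bias; [exact: bounded_mfun_clamp|apply: bounded_mfunB; exact: bounded_mfun_ler|].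
move=> z y; rewrite RintegralB//; last 2 first.
- apply: (bounded_mfun_integrable U); apply: (bounded_mfun_comp (bounded_mfun_ler a)).
  by apply: measurable_funD => //; exact: measurable_funM.
- apply: (bounded_mfun_integrable U); apply: (bounded_mfun_comp (bounded_mfun_ler b)).
  by apply: measurable_funD => //; exact: measurable_funM.
rewrite mulrBr !ramp_average /clamp; ring.
Qed.

Lemma zeta_norm_int : zeta.-integrable setT (EFin \o (fun s => `|s|)).
Proof. exact: integrable_normr. Qed.

Lemma zeta_mul_int f : bounded_mfun f -> zeta.-integrable setT (EFin \o (fun s => s * f s)).
Proof. by move=> [mf [K fK]]; exact: (@integrableM_bounded R _ _ _ id f K). Qed.

(* The identity [E (Z^2) = 1], unavailable for unbounded test functions, is replaced
   by a clamped one and [2 |s| - 1 <= s * clamp (-2) 2 s]. *)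
Lemma mean_norm_zeta : \int[zeta]_s `|s| <= 1.
Proof.
have ab : (-2 : R) <= 2 by lra.
have H : \int[zeta]_s (s * clamp (-2) 2 s) <= 1.
  rewrite clamp_bias// -[leRHS]weight1 -[leRHS]mul1r -bias_cst; last exact: bounded_mfun1.
  have bb : bounded_mfun (fun s => (-2 <= s)%R%:R - (2 <= s)%R%:R) by apply: bounded_mfunB; exact: bounded_mfun_ler.
  apply: le_bias => //; [exact: bounded_mfun1|exact: bounded_mfun_shift_mean|exact: bounded_mfun_cst|].
  move=> t; apply: Rintegral_le_bound.
    apply: (bounded_mfun_integrable zeta); apply: (bounded_mfun_comp bb); exact: measurable_funD.
  by move=> s; case: (leP (-2) (s + t)) => h1; case: (leP 2 (s + t)) => h2 /=; lra.
have i2 : zeta.-integrable setT (EFin \o (fun s => 2 * `|s| - 1)).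
  have i1 := integrableZl measurableT 2 zeta_norm_int.
  have := integrableB measurableT i1 (bounded_mfun_integrable zeta bounded_mfun1).
  by apply: eq_integrable.
have : \int[zeta]_s (2 * `|s| - 1) <= 1.
  apply: le_trans H; apply: le_Rintegral => //.
    exact/zeta_mul_int/bounded_mfun_clamp.
  move=> s _; rewrite /clamp !rampE.
  have q1 := sqr_ge0 (s + 1); have q2 := sqr_ge0 (s - 1).
  rewrite !expr2 in q1 q2.
  have [s0|s0] := ler0P s.
    case: (ltP s (-2)) => h1; first by rewrite ifT; lra.
    by rewrite ifT; lra.
  rewrite ifF; last by apply/negbTE; rewrite -leNgt; lra.
  by case: (ltP s 2) => h2; lra.
rewrite RintegralB//; last 2 first.
- by have := integrableZl measurableT 2 zeta_norm_int; apply: eq_integrable.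
- exact: (bounded_mfun_integrable zeta bounded_mfun1).
rewrite RintegralZl//; last exact: zeta_norm_int.
rewrite Rintegral_cst_prob; lra.
Qed.

(** The left side is the probability that [Z + V] lies in [[a, b)]. *)
Lemma bias_lipschitz a (b : R) : a <= b ->
  bias (fun=> 1) (fun t => F (b - t) - F (a - t)) <= (b - a) / 2.
Proof.
move=> ab.
have -> : (fun t => F (b - t) - F (a - t)) =
    shift_mean (fun s => (a <= s)%R%:R - (b <= s)%R%:R).
  apply/funext => t; rewrite /F -RintegralB//; [|exact: (bounded_mfun_integrable zeta (bounded_mfun_ltr _))..].
  apply: eq_Rintegral => s _; rewrite !ltrBrDr !ltNge.
  by case: (a <= s + t); case: (b <= s + t) => /=; lra.
rewrite -clamp_bias//.
apply: (@le_trans _ _ (\int[zeta]_s ((b - a) / 2 * `|s|))).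
  apply: le_Rintegral => //.
  - exact/zeta_mul_int/bounded_mfun_clamp.
  - by have := integrableZl measurableT ((b - a) / 2) zeta_norm_int; apply: eq_integrable.
  - move=> s _; rewrite (le_trans (ler_norm _))// normrM mulrC ler_wpM2r//.
    exact: clamp_bound.
rewrite RintegralZl//; last exact: zeta_norm_int.
rewrite -[leRHS]mulr1 ler_wpM2l// ?mean_norm_zeta//; lra.
Qed.

(** * Stein's equation under the coupling *)

Local Notation Phi := (@std_normal_cdf R).

Definition stein_gap x t := shift_mean (stein_deriv x) 0 - shift_mean (stein_deriv x) t.

Lemma bounded_mfun_stein x : bounded_mfun (stein x).
Proof.
split; first exact: measurable_stein.
by exists 1 => z; rewrite ger0_norm ?stein_le1// stein_ge0.
Qed.

Lemma bounded_mfun_stein_deriv x : bounded_mfun (stein_deriv x).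
Proof.
split; first exact: measurable_stein_deriv.
by exists 1 => z; exact: stein_deriv_bound.
Qed.

Lemma shift_mean_stein_derivE x t : shift_mean (stein_deriv x) t =
  \int[zeta]_s ((s + t) * stein x (s + t)) + F (x - t) - Phi x.
Proof.
have bs : bounded_mfun (fun s => stein x (s + t)).
  by apply: (bounded_mfun_comp (bounded_mfun_stein x)); exact: measurable_funD.
have i1 : zeta.-integrable setT (EFin \o (fun s => (s + t) * stein x (s + t))).
  have := integrableD measurableT (zeta_mul_int bs) (bounded_mfun_integrable zeta (bounded_mfunZ t bs)).
  by apply: eq_integrable => // s _; rewrite /= mulrDl.
have i2 := bounded_mfun_integrable zeta (bounded_mfun_ltr (x - t)).
rewrite /F -RintegralD// -[Phi x in RHS](Rintegral_cst_prob zeta) -RintegralB//.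
- apply: eq_Rintegral => s _; rewrite /stein_deriv -ltrBrDr//.
- by have := integrableD measurableT i1 i2; apply: eq_integrable.
- exact: (bounded_mfun_integrable zeta (bounded_mfun_cst _)).
Qed.

(** Stein's equation integrated against [zeta] expresses the left side as the mean of
    [stein_deriv x s - s * stein x s]; [zero_bias] rewrites the second term. *)
Lemma strict_cdf_sub_Phi x : F x - Phi x = bias (fun=> 1) (stein_gap x).
Proof.
rewrite biasB; [|exact: bounded_mfun1|exact: bounded_mfun_cst|exact/bounded_mfun_shift_mean/bounded_mfun_stein_deriv].
rewrite bias_cst; last exact: bounded_mfun1.
rewrite weight1 mulr1 -(zero_bias (bounded_mfun_stein x) (bounded_mfun_stein_deriv x)); last first.
  by move=> z y; exact: stein_average.
rewrite shift_mean_stein_derivE subr0.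
under eq_Rintegral do rewrite addr0; ring.
Qed.

Lemma bounded_mfun_stein_gap x : bounded_mfun (stein_gap x).
Proof. by apply: bounded_mfunB; [exact: bounded_mfun_cst|exact/bounded_mfun_shift_mean/bounded_mfun_stein_deriv]. Qed.

Lemma stein_gap_le1 x t : `|stein_gap x t| <= 1.
Proof.
have bb := bounded_mfun_stein_deriv x.
have i r : zeta.-integrable setT (EFin \o (fun s => stein_deriv x (s + r))).
  by apply: (bounded_mfun_integrable zeta); apply: (bounded_mfun_comp bb); exact: measurable_funD.
rewrite /stein_gap /shift_mean -RintegralB//.
apply: Rintegral_norm_bound.
  by have := integrableB measurableT (i 0) (i t); apply: eq_integrable.
move=> s; rewrite ler_norml.
have h1 := stein_deriv_diff x (s + 0) (s + t).
have h2 := stein_deriv_diff x (s + t) (s + 0).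
by apply/andP; split; lra.
Qed.

Lemma stein_lipschitz x s t : `|stein x (s + t) - stein x s| <= `|t|.
Proof.
rewrite -stein_average normrM -[leRHS]mulr1 ler_wpM2l//.
apply: Rintegral_norm_bound; last by move=> u; exact: stein_deriv_bound.
apply: (bounded_mfun_integrable U); apply: (bounded_mfun_comp (bounded_mfun_stein_deriv x)).
by apply: measurable_funD => //; exact: measurable_funM.
Qed.

Lemma mul_stein_gap x t :
  `|\int[zeta]_s ((s + 0) * stein x (s + 0)) - \int[zeta]_s ((s + t) * stein x (s + t))|
    <= 2 * `|t|.
Proof.
have i r : zeta.-integrable setT (EFin \o (fun s => (s + r) * stein x (s + r))).
  have bs : bounded_mfun (fun s => stein x (s + r)).
    by apply: (bounded_mfun_comp (bounded_mfun_stein x)); exact: measurable_funD.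
  have := integrableD measurableT (zeta_mul_int bs) (bounded_mfun_integrable zeta (bounded_mfunZ r bs)).
  by apply: eq_integrable => // s _; rewrite /= mulrDl.
rewrite -RintegralB//.
have i' : zeta.-integrable setT (EFin \o (fun s => (s + 0) * stein x (s + 0) - (s + t) * stein x (s + t))).
  by have := integrableB measurableT (i 0) (i t); apply: eq_integrable.
apply: (le_trans (le_normr_Rintegral _ i')) => //.
have i3 : zeta.-integrable setT (EFin \o (fun s => `|t| * (`|s| + 1))).
  have := integrableZl measurableT `|t| (integrableD measurableT zeta_norm_int (bounded_mfun_integrable zeta bounded_mfun1)).
  by apply: eq_integrable.
apply: (@le_trans _ _ (\int[zeta]_s (`|t| * (`|s| + 1)))).
  apply: le_Rintegral => //.
    exact: integrable_normr.
  move=> s _; rewrite addr0.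
  have -> : s * stein x s - (s + t) * stein x (s + t) =
     - (s * (stein x (s + t) - stein x s) + t * stein x (s + t)) by ring.
  rewrite normrN (le_trans (ler_normD _ _))// [leRHS]mulrDr mulr1 !normrM lerD//.
  - by rewrite mulrC ler_wpM2r// stein_lipschitz.
  - by rewrite -[leRHS]mulr1 ler_wpM2l// ger0_norm ?stein_le1// stein_ge0.
rewrite RintegralZl//; last first.
  by have := integrableD measurableT zeta_norm_int (bounded_mfun_integrable zeta bounded_mfun1); apply: eq_integrable.
rewrite RintegralD//; [|exact: zeta_norm_int|exact: (bounded_mfun_integrable zeta bounded_mfun1)].
by rewrite Rintegral_cst_prob mulrC ler_wpM2r//; have := mean_norm_zeta; lra.
Qed.

(* [f'(s) = s f(s) + 1(s < x) - Phi x], and [s f(s)] is Lipschitz up to the factor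
   [|s| + 1], whose mean is at most 2. *)
Lemma stein_gapE x t : exists2 r, `|r| <= 2 * `|t| &
  stein_gap x t = r + (F x - F (x - t)).
Proof.
exists (\int[zeta]_s ((s + 0) * stein x (s + 0)) - \int[zeta]_s ((s + t) * stein x (s + t))).
  exact: mul_stein_gap.
rewrite /stein_gap !shift_mean_stein_derivE subr0.
move: (Rintegral _ _ _) (Rintegral _ _ _) => I0 It; ring.
Qed.

(** For [|t| > 1] the trivial bound suffices, as [1 <= 2 + D]. The cap keeps the majorant bounded,
    so that [bias] can be applied to it. *)
Lemma norm_min_le (r t D : R) : `|r| <= 2 * `|t| -> `|r + D| <= 1 -> -1 <= D ->
  r + D <= 2 * Num.min `|t| 1 + D.
Proof.
rewrite !ler_norml => /andP[h1 h2] /andP[h3 h4] h5.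
by case: (leP `|t| 1) => t1; lra.
Qed.

Lemma stein_gap_le x t : stein_gap x t <= 2 * Num.min `|t| 1 + (F x - F (x - t)).
Proof.
have h := stein_gap_le1 x t.
have f1 := strict_cdf_ge0 x; have f2 := strict_cdf_le1 (x - t).
have [r rt E] := stein_gapE x t.
rewrite E in h *; apply: norm_min_le => //; lra.
Qed.

Lemma stein_gap_ge x t : - stein_gap x t <= 2 * Num.min `|t| 1 + (F (x - t) - F x).
Proof.
have h := stein_gap_le1 x t.
have f1 := strict_cdf_le1 x; have f2 := strict_cdf_ge0 (x - t).
have [r rt E] := stein_gapE x t.
rewrite E in h *; rewrite -normrN opprD opprB in h; rewrite opprD opprB.
apply: norm_min_le => //; [by rewrite normrN|lra].
Qed.

(** * Splitting into small and large jumps *)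

Definition small x : R := (`|x| <= 1)%R%:R.
Definition large x : R := 1 - small x.

Lemma bounded_mfun_small : bounded_mfun small.
Proof.
split; last by exists 1 => x; rewrite /small; case: (`|x| <= 1); rewrite ?normr1 ?normr0.
have E x : small x = if `|x| <= 1 then 1 else 0 by rewrite /small; case: (`|x| <= 1).
rewrite (_ : small = fun x => if `|x| <= 1 then 1 else 0); last exact/funext.
apply: measurable_fun_ifT => //.
by apply: measurable_fun_ler => //; exact: normr_measurable.
Qed.

Lemma bounded_mfun_large : bounded_mfun large.
Proof. by apply: bounded_mfunB; [exact: bounded_mfun1|exact: bounded_mfun_small]. Qed.

Lemma small_ge0 x : 0 <= small x.
Proof. exact: ler0n. Qed.

Lemma small_le1 x : small x <= 1.
Proof. by rewrite /small; case: (`|x| <= 1); rewrite ?lexx ?ler01. Qed.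

Lemma large_ge0 x : 0 <= large x.
Proof. by rewrite /large subr_ge0 small_le1. Qed.

Lemma bounded_mfun_small_norm : bounded_mfun (fun x => small x * `|x|).
Proof.
have [m _] := bounded_mfun_small; split.
  by apply: measurable_funM => //; exact: normr_measurable.
exists 1 => x; rewrite /small normrM normr_id; case: (leP `|x| 1) => x1 /=.
  by rewrite normr1 mul1r.
by rewrite normr0 mul0r.
Qed.

(** [w] is the share of the unit variance carried by the small jumps, and [M1] is [lambda] times
    their third absolute moment. *)
Let w := weight small.
Let M1 := weight (fun x => small x * `|x|).

Lemma weightD W1 W2 : bounded_mfun W1 -> bounded_mfun W2 ->
  weight (fun x => W1 x + W2 x) = weight W1 + weight W2.
Proof.
move=> b1 b2; rewrite /weight -mulrDr -RintegralD//; [|exact: weight_integrable..].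
by congr (_ * _); apply: eq_Rintegral => x _; rewrite mulrDr.
Qed.

Lemma weight_ge0 W : bounded_mfun W -> (forall x, 0 <= W x) -> 0 <= weight W.
Proof.
move=> bW W0; rewrite mulr_ge0 ?(ltW lambda0)//.
by apply: Rintegral_ge0 => x _; rewrite mulr_ge0 ?sqr_ge0.
Qed.

Lemma weight_small_large : w + weight large = 1.
Proof.
rewrite /w -weightD; [|exact: bounded_mfun_small|exact: bounded_mfun_large].
by rewrite -[RHS]weight1; congr weight; apply/funext => x; rewrite /large addrC subrK.
Qed.

Lemma w_le1 : w <= 1.
Proof.
by rewrite -weight_small_large lerDl; apply: weight_ge0; [exact: bounded_mfun_large|exact: large_ge0].
Qed.

Definition moment := weight (fun x => Num.min 1 `|x|).

Lemma momentE : moment = M1 + weight large.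
Proof.
rewrite /M1 -weightD; [|exact: bounded_mfun_small_norm|exact: bounded_mfun_large].
congr weight; apply/funext => x; rewrite /large /small minC.
by case: (leP `|x| 1) => x1 /=; rewrite ?mul1r ?mul0r ?subrr ?subr0 ?addr0 ?add0r.
Qed.

Lemma small_lipschitz a (b : R) : a <= b ->
  bias small (fun t => F (b - t) - F (a - t)) <= (b - a) / 2.
Proof.
move=> ab; apply: le_trans (bias_lipschitz ab).
have bF : bounded_mfun (fun t => F (b - t) - F (a - t)) by apply: bounded_mfunB; exact: bounded_mfun_cdfB.
have -> : (fun=> 1) = (fun x => small x + large x).
  by apply/funext => x; rewrite /large addrC subrK.
rewrite bias_splitW//; [|exact: bounded_mfun_small|exact: bounded_mfun_large].
rewrite lerDl; apply: (@le_trans _ _ (bias large (fun=> 0))).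
  by rewrite bias_cst ?mul0r//; exact: bounded_mfun_large.
apply: le_bias => //; [exact: bounded_mfun_large|exact: bounded_mfun_cst|exact: large_ge0|].
by move=> t; rewrite subr_ge0 strict_cdf_monotone// lerB.
Qed.

(** The cap 2 makes this a bounded test function; it loses nothing, since the slope used with it is
    at least 1/2 and [F] never varies by more than 1. *)
Definition excess D t : R := Num.min (ramp D `|t|) 2.
Definition exceeds D t : R := (D < `|t|)%R%:R.

Lemma ramp_ge0 a z : 0 <= ramp a z.
Proof. by rewrite /ramp le_max lexx orbT. Qed.

Lemma bounded_mfun_excess D : bounded_mfun (excess D).
Proof.
split.
  apply: measurable_funTS; apply: measurable_minr => //.
  exact: (measurableT_comp (measurable_ramp D) (@normr_measurable R setT)).
exists 2 => t; rewrite ger0_norm; first by rewrite /excess ge_min lexx orbT.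
by rewrite /excess le_min ramp_ge0/=.
Qed.

Lemma bounded_mfun_exceeds D : bounded_mfun (exceeds D).
Proof.
split; last by exists 1 => t; rewrite /exceeds; case: (_ < _); rewrite ?normr1 ?normr0.
have E t : exceeds D t = if D < `|t| then 1 else 0 by rewrite /exceeds; case: (_ < _).
rewrite (_ : exceeds D = fun t => if D < `|t| then 1 else 0); last exact/funext.
apply: measurable_fun_ifT => //.
by apply: measurable_fun_ltr => //; exact: normr_measurable.
Qed.

(** On the support of the uniform law [|u * x| = u * |x|], which removes the sign of [x]. [H] needs
    a bound on [[0, |x|]] only, so unbounded comparison functions are allowed. *)
Lemma section_norm_le G H x K : bounded_mfun G -> measurable_fun setT H ->
  (forall t, 0 <= t <= `|x| -> `|H t| <= K) ->
  (forall t, `|t| <= `|x| -> G t <= H `|t|) ->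
  \int[U]_u G (u * x) <= \int[U]_u H (u * `|x|).
Proof.
move=> bG mH HK GH.
have [mG [KG GK]] := bounded_mfun_section x bG.
have mHx : measurable_fun setT (fun u : R => H (u * `|x|)).
  by apply: (measurableT_comp mH); exact: measurable_funM.
have u01 u : u \in `[0, 1] -> `|u * x| = u * `|x| /\ 0 <= u * `|x| <= `|x|.
  rewrite in_itv/= => /andP[u0 u1]; rewrite normrM ger0_norm//; split => //.
  by rewrite mulr_ge0//= ler_piMl.
rewrite !Rintegral_unif01// !Rintegral_uniform//.
have I01 (h : R -> R) C : measurable_fun setT h -> (forall u, u \in `[0, 1] -> `|h u| <= C) ->
    (@lebesgue_measure R).-integrable `[0, 1] (EFin \o h).
  move=> mh hC; apply: measurable_bounded_integrable => //.
  - by rewrite /= lebesgue_measure_itv/= lte_fin ltr01 ltry.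
  - exact: measurable_funTS.
  - exists C; split; first exact: num_real.
    by move=> M CM u uI; apply: ltW; apply: le_lt_trans CM; exact: hC.
apply: le_Rintegral => //.
- by apply: (I01 _ KG).
- by apply: (I01 _ K) => // u /u01[_ h]; exact: HK.
- by move=> u /u01[e /andP[_ h]]; rewrite -e; apply: GH; rewrite e.
Qed.

(** Without the cap, the substitution [t = u * |x|] leaves the integral of [ramp D] over [[0, |x|]].
    The next two averages are computed in the same way. *)
Lemma excess_average (D x : R) : 0 < D ->
  `|x| * \int[U]_u excess D (u * x) <= ramp D `|x| ^+ 2 / 2.
Proof.
move=> D0; have mr := measurable_ramp D.
have rK t : 0 <= t <= `|x| -> `|ramp D t| <= `|x|.
  move=> /andP[t0 tx]; rewrite ger0_norm ?ramp_ge0// /ramp ge_max normr_ge0 andbT.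
  lra.
have -> : ramp D `|x| ^+ 2 / 2 = `|x| * \int[U]_u ramp D (u * `|x|).
  have H : `|x| * \int[U]_u ramp D (0 + u * `|x|) =
      ramp D (0 + `|x|) ^+ 2 / 2 - ramp D 0 ^+ 2 / 2.
    apply: (@unif01_average_glue R (ramp D) (fun t => ramp D t ^+ 2 / 2)
      (fun=> 0) (fun t => (t - D) ^+ 2 / 2) (fun=> 0) (fun t => t - D) D 0 `|x| `|x|).
    - exact: rampE.
    - by move=> t; rewrite rampE; case: ifP => // _; rewrite expr0n/= mul0r.
    - exact: mr.
    - move=> u /andP[u0 u1]; rewrite add0r; apply: rK.
      by rewrite mulr_ge0//= ler_piMl.
    - by move=> t; exact: cvg_cst.
    - by move=> t; apply: cvgB; [exact: cvg_id|exact: cvg_cst].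
    - by move=> t; apply: is_derive_eq; rewrite /GRing.scale/=; field.
    - by rewrite subrr expr0n/= mul0r.
  have r0 : ramp D 0 = 0 by rewrite rampE D0.
  rewrite r0 expr0n/= mul0r subr0 add0r in H; rewrite -H.
  by congr (_ * _); apply: eq_Rintegral => u _; rewrite add0r.
rewrite ler_wpM2l//; apply: (section_norm_le (K := `|x|)) => //.
- exact: bounded_mfun_excess.
- by move=> t _; rewrite /excess ge_min lexx.
Qed.

Lemma exceeds_average (D x : R) : 0 < D ->
  `|x| * \int[U]_u exceeds D (u * x) <= ramp D `|x|.
Proof.
move=> D0.
have -> : ramp D `|x| = `|x| * \int[U]_u (D <= u * `|x|)%R%:R.
  have := ramp_average D 0 `|x|; rewrite add0r [ramp D 0]rampE D0 subr0 => <-.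
  by congr (_ * _); apply: eq_Rintegral => u _; rewrite add0r.
rewrite ler_wpM2l//; apply: (section_norm_le (K := 1) (H := fun t => (D <= t)%R%:R)) => //.
- exact: bounded_mfun_exceeds.
- by have [] := bounded_mfun_ler D.
- by move=> t _; case: (D <= t); rewrite ?normr1 ?normr0.
- by move=> t _; rewrite /exceeds; case: (ltP D `|t|) => [/ltW -> //|_]; exact: ler0n.
Qed.

Lemma min_norm_average x : `|x| * \int[U]_u Num.min `|u * x| 1 <= x ^+ 2 / 2.
Proof.
have -> : x ^+ 2 / 2 = `|x| * \int[U]_u (u * `|x|).
  have H : `|x| * \int[U]_u (0 + u * `|x|) = (0 + `|x|) ^+ 2 / 2 - 0 ^+ 2 / 2.
    apply: (@unif01_average_glue R id (fun t => t ^+ 2 / 2)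
      (fun t => t ^+ 2 / 2) (fun t => t ^+ 2 / 2) id id 0 0 `|x| `|x|).
    - by move=> t; case: ifP.
    - by move=> t; case: ifP.
    - by [].
    - move=> u /andP[u0 u1]; rewrite add0r ger0_norm ?mulr_ge0//.
      by rewrite ler_piMl.
    - by move=> t; exact: cvg_id.
    - by move=> t; exact: cvg_id.
    - by move=> t; apply: is_derive_eq; rewrite /GRing.scale/=; field.
    - by move=> t; apply: is_derive_eq; rewrite /GRing.scale/=; field.
    - by [].
  rewrite add0r expr0n/= mul0r subr0 real_normK ?num_real// in H; rewrite -H.
  by congr (_ * _); apply: eq_Rintegral => u _; rewrite add0r.
rewrite ler_wpM2l//; apply: (section_norm_le (K := `|x|) (H := id) (G := fun t => Num.min `|t| 1)) => //.
- split.
    by apply: measurable_minr => //; exact: normr_measurable.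
  by exists 1 => t; rewrite ger0_norm ?ge_min ?lexx ?orbT// le_min normr_ge0/=.
- by move=> t /andP[t0 tx]; rewrite ger0_norm.
- by move=> t _; rewrite ge_min lexx.
Qed.

(** Of the weight [x ^+ 2 = |x| * |x|], one factor goes into the hypothesis on [G] and the other
    stays to form the third moment [M1]. *)
Lemma bias_small_le G C : bounded_mfun G ->
  (forall x, `|x| * \int[U]_u G (u * x) <= C * x ^+ 2) ->
  bias small G <= C * M1.
Proof.
move=> bG GC; rewrite biasE//; last exact: bounded_mfun_small.
rewrite /M1 /weight mulrCA ler_wpM2l ?(ltW lambda0)//.
rewrite -RintegralZl//; last exact: (weight_integrable bounded_mfun_small_norm).
have i1 : rho.-integrable setT (EFin \o (fun x => x ^+ 2 * (small x * \int[U]_u G (u * x)))).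
  have [mG [K GK]] := bG; have [ms _] := bounded_mfun_small.
  have bA : bounded_mfun (fun x => \int[U]_u G (u * x)).
    split.
      apply: (@measurable_Rintegral_snd R _ _ _ _ rho U (fun p => G (p.2 * p.1))).
      apply: (@bounded_integrable R _ _ (rho \x U)%E _ K) => //.
      exact: (measurableT_comp mG measurable_scale).
    exists K => x; apply: Rintegral_norm_bound => //.
    exact: (bounded_mfun_integrable U (bounded_mfun_section x bG)).
  exact: (weight_integrable (bounded_mfunM bounded_mfun_small bA)).
apply: le_Rintegral => //.
  by have := integrableZl measurableT C (weight_integrable bounded_mfun_small_norm); apply: eq_integrable.
move=> x _.
have -> : x ^+ 2 = `|x| * `|x| by rewrite -expr2 real_normK// num_real.
have := GC x; have -> : x ^+ 2 = `|x| * `|x| by rewrite -expr2 real_normK// num_real.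
have := small_ge0 x; have := normr_ge0 x.
move: (`|x|) (small x) (Rintegral _ _ _) => y p I y0 p0 H.
have -> : y * y * (p * I) = (y * p) * (y * I) by ring.
have -> : C * (y * y * (p * y)) = (y * p) * (C * (y * y)) by ring.
by rewrite ler_wpM2l// mulr_ge0.
Qed.

(* The error made when [F x] is replaced by [F (x + D - t)] or [F (x - D - t)], if
   [F] oscillates by at most [c * r + e] over distance [r]. *)
Definition overshoot c e D t := c * excess D t + e * exceeds D t.

Lemma bounded_mfun_overshoot c e D : bounded_mfun (overshoot c e D).
Proof. by apply: bounded_mfunD; apply: bounded_mfunZ; [exact: bounded_mfun_excess|exact: bounded_mfun_exceeds]. Qed.

(* The hypothesis is that a quadratic form in the pair [(r, D)], [r = |x| - D], is
   nonnegative; [C] is chosen to make it a perfect square. *)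
Lemma overshoot_bias (c e D C : R) : 0 < D -> 0 <= c -> 0 <= e ->
  (forall r, 0 <= r -> c * (r ^+ 2 / 2) + e * r <= C * (r + D) ^+ 2) ->
  bias small (overshoot c e D) <= C * M1.
Proof.
move=> D0 c0 e0 H; apply: bias_small_le; first exact: bounded_mfun_overshoot.
move=> x; rewrite /overshoot RintegralD//; last 2 first.
- exact: (bounded_mfun_integrable U (bounded_mfun_section x (bounded_mfunZ c (bounded_mfun_excess D)))).
- exact: (bounded_mfun_integrable U (bounded_mfun_section x (bounded_mfunZ e (bounded_mfun_exceeds D)))).
rewrite !RintegralZl//; last 2 first.
- exact: (bounded_mfun_integrable U (bounded_mfun_section x (bounded_mfun_exceeds D))).
- exact: (bounded_mfun_integrable U (bounded_mfun_section x (bounded_mfun_excess D))).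
rewrite mulrDr !(mulrCA `|x|).
have h1 := ler_wpM2l c0 (excess_average x D0).
have h2 := ler_wpM2l e0 (exceeds_average x D0).
apply: (le_trans (lerD h1 h2)).
have C0 : 0 <= C.
  have := H 0 (lexx _); rewrite expr0n/= mul0r !mulr0 !add0r.
  by rewrite pmulr_lge0// exprn_gt0.
rewrite rampE; case: ltP => xD.
  by rewrite expr0n/= mul0r !mulr0 addr0 mulr_ge0// sqr_ge0.
have r0 : 0 <= `|x| - D by rewrite subr_ge0.
by apply: (le_trans (H _ r0)); rewrite subrK real_normK// num_real.
Qed.

(** * Concentration inequality for the compound sum, and removal of the shift *)

Section concentration.
Hypothesis w_gt0 : 0 < w.
(** The slope 1/2 from [small_lipschitz], divided by the weight of the small jumps. *)
Let k := (2 * w)^-1.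

Let k_ge : 2^-1 <= k.
Proof.
have w2 : 0 < 2 * w by rewrite mulr_gt0.
have h : 2 * w <= 2 by rewrite -[leRHS]mulr1 ler_pM2l// w_le1.
by rewrite /k lef_pV2 ?posrE.
Qed.

Definition oscillation_le e := forall x u, u <= x -> F x - F u <= (x - u) * k + e.

(** For [r > 2] the cap is harmless, since [2 * k >= 1] bounds any difference of values of [F]. *)
Lemma oscillation_min e x r : 0 <= e -> oscillation_le e -> 0 <= r ->
  F x - F (x - r) <= k * Num.min r 2 + e.
Proof.
move=> e0 H r0; have kg := k_ge.
case: (leP r 2) => r2.
  have := H x (x - r); rewrite gerBl => /(_ r0).
  by have -> : x - (x - r) = r by [ring]; rewrite mulrC.
have f1 := strict_cdf_le1 x; have f2 := strict_cdf_ge0 (x - r); lra.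
Qed.

Lemma overshoot_ge0 e D t : 0 <= e -> 0 <= overshoot k e D t.
Proof.
move=> e0; rewrite addr_ge0// mulr_ge0//.
- exact: le_trans k_ge.
- by rewrite /excess le_min ramp_ge0/=.
Qed.

Lemma overshoot_right e D x t : 0 < D -> 0 <= e -> oscillation_le e ->
  F x - F (x + D - t) <= overshoot k e D t.
Proof.
move=> D0 e0 H; have [tD|tD] := leP t D.
  apply: (@le_trans _ _ 0); last exact: overshoot_ge0.
  by rewrite subr_le0 strict_cdf_monotone//; lra.
have t0 : `|t| = t by rewrite ger0_norm//; lra.
rewrite /overshoot /excess /exceeds t0 tD mulr1 rampE ltNge (ltW tD)/=.
have -> : x + D - t = x - (t - D) by ring.
by apply: oscillation_min => //; lra.
Qed.

Lemma overshoot_left e D x t : 0 < D -> 0 <= e -> oscillation_le e ->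
  F (x - D - t) - F x <= overshoot k e D t.
Proof.
move=> D0 e0 H; have [tD|tD] := leP (- D) t.
  apply: (@le_trans _ _ 0); last exact: overshoot_ge0.
  by rewrite subr_le0 strict_cdf_monotone//; lra.
have t0 : `|t| = - t by rewrite ler0_norm//; lra.
have tD' : D < - t by lra.
rewrite /overshoot /excess /exceeds t0 tD' mulr1 rampE ltNge (ltW tD')/=.
have := @oscillation_min e (x - D - t) (- t - D) e0 H.
have -> : x - D - t - (- t - D) = x by ring.
by apply; lra.
Qed.

(** The interval is enlarged by [D] on both sides, so that a translation by [|t| <= D] keeps it
    inside; larger translations are paid for by [overshoot]. *)
Lemma concentration_step e D x u : 0 < D -> 0 <= e -> oscillation_le e -> u <= x ->
  w * (F x - F u) <= (x - u) / 2 + D + bias small (overshoot k e D).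
Proof.
move=> D0 e0 H ux.
have ab : u - D <= x + D by lra.
have -> : (x - u) / 2 + D = (x + D - (u - D)) / 2 by field.
rewrite -lerBlDr; apply: le_trans (small_lipschitz ab).
rewrite mulrC -(bias_cst _ bounded_mfun_small) -biasB; [|exact: bounded_mfun_small|exact: bounded_mfun_cst|exact: bounded_mfun_overshoot].
apply: le_bias.
- exact: bounded_mfun_small.
- by apply: bounded_mfunB; [exact: bounded_mfun_cst|exact: bounded_mfun_overshoot].
- by apply: bounded_mfunB; exact: bounded_mfun_cdfB.
- exact: small_ge0.
move=> t.
have h1 := @overshoot_right e D x t D0 e0 H.
have h2 := @overshoot_left e D u t D0 e0 H.
have h0 := @overshoot_ge0 e D t e0.
(* Each sign of [t] endangers only one endpoint, so a single [overshoot] suffices. *)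
have [t0|t0] := leP 0 t.
  have : F (u - D - t) <= F u by apply: strict_cdf_monotone; lra.
  lra.
have : F x <= F (x + D - t) by apply: strict_cdf_monotone; lra.
lra.
Qed.

(* Taking the least admissible [e], which is finite since [F] is bounded, the
   concentration step with [D = e * w / 2] bounds [e] by [e / 2] plus the moment. *)
Lemma oscillation_le_moment : oscillation_le (8 / 7 * (M1 / w ^+ 2)).
Proof.
pose A := [set r | exists x u, u <= x /\ r = F x - F u - (x - u) * k].
have M1_ge0 : 0 <= M1.
  by apply: weight_ge0; [exact: bounded_mfun_small_norm|move=> x; rewrite mulr_ge0// small_ge0].
have k0 : 0 <= k by apply: le_trans k_ge.
have A0 : A 0 by exists 0, 0; split => //; rewrite !subrr mul0r subr0.
have Aub : ubound A 1.
  move=> _ [x [u [ux ->]]]; have f1 := strict_cdf_le1 x; have f2 := strict_cdf_ge0 u.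
  have : 0 <= (x - u) * k by rewrite mulr_ge0// subr_ge0.
  lra.
have supA : has_sup A by split; [exists 0|exists 1].
pose e := sup A.
have e_ub : oscillation_le e.
  move=> x u ux; have : F x - F u - (x - u) * k <= e.
    by apply: sup_upper_bound => //; exists x, u.
  lra.
have e0 : 0 <= e by apply: sup_upper_bound.
suff E : e <= 8 / 7 * (M1 / w ^+ 2) by move=> x u ux; apply: (le_trans (e_ub x u ux)); rewrite lerD2l.
have Mw : 0 <= M1 / w ^+ 2 by rewrite divr_ge0// sqr_ge0.
(* The width [D = e * w / 2] has to be positive; for [e <= 0] the claim is trivial. *)
have [en|ep] := leP e 0; first by apply: (le_trans en); rewrite mulr_ge0.
suff : e <= e / 2 + 4 / 7 * (M1 / w ^+ 2) by lra.
apply: ge_sup; first by exists 0.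
move=> _ [x [u [ux ->]]].
pose D := e * w / 2.
have D0 : 0 < D by rewrite /D divr_gt0// mulr_gt0.
have wn0 : w != 0 by rewrite gt_eqF.
(* With [e = 2 * D / w] the quadratic form has zero discriminant exactly for [C * w = 4 / 7]. *)
have B : bias small (overshoot k e D) <= 4 / 7 / w * M1.
  apply: overshoot_bias => //.
  move=> r r0; rewrite -subr_ge0.
  have -> : 4 / 7 / w * (r + D) ^+ 2 - (k * (r ^+ 2 / 2) + e * r) =
      (3 * r - 4 * D) ^+ 2 / (28 * w) by rewrite /k /D; field.
  by rewrite divr_ge0 ?sqr_ge0// mulr_ge0// ltW.
have S := @concentration_step e D x u D0 e0 e_ub ux.
rewrite -(ler_pM2l w_gt0).
have -> : w * (F x - F u - (x - u) * k) = w * (F x - F u) - (x - u) / 2.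
  by rewrite /k; field.
have -> : w * (e / 2 + 4 / 7 * (M1 / w ^+ 2)) = D + 4 / 7 / w * M1.
  by rewrite /D; field.
lra.
Qed.

(** A positive upper bound [m] takes the place of [M1], which may vanish, because [D] must be
    positive. The term [D / 2] is the later cost of a shift by [D]. *)
Lemma overshoot_optimized m : 0 < m -> M1 <= m ->
  exists2 D, 0 < D & exists e, [/\ 0 <= e, oscillation_le e &
    D / 2 + bias small (overshoot k e D) <= (8 / 21 + 9 / 20) * (m / w)].
Proof.
(* Here [D = 2 / 3 * e * w], a wider margin than in the bootstrap since a shift by [D] now occurs on
   one side only; the discriminant then vanishes for [C * w = 9 / 20]. *)
move=> m0 Mm; pose e := 8 / 7 * (m / w ^+ 2); pose D := 16 / 21 * (m / w).
have wn0 : w != 0 by rewrite gt_eqF.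
have e0 : 0 <= e by rewrite /e mulr_ge0// divr_ge0 ?sqr_ge0// ltW.
have D0 : 0 < D by rewrite /D mulr_gt0// divr_gt0.
exists D => //; exists e; split => //.
  move=> x u ux; apply: (le_trans (oscillation_le_moment ux)).
  by rewrite lerD2l ler_wpM2l// ler_wpM2r// invr_ge0 sqr_ge0.
have B : bias small (overshoot k e D) <= 9 / 20 / w * M1.
  apply: overshoot_bias => //; first exact: le_trans k_ge.
  move=> r r0; rewrite -subr_ge0.
  have -> : 9 / 20 / w * (r + D) ^+ 2 - (k * (r ^+ 2 / 2) + e * r) =
      (2 * r - 3 * D) ^+ 2 / (20 * w) by rewrite /k /e /D; field.
  by rewrite divr_ge0 ?sqr_ge0// mulr_ge0// ltW.
have B' : 9 / 20 / w * M1 <= 9 / 20 / w * m.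
  by rewrite ler_wpM2l// divr_ge0// ltW.
have -> : (8 / 21 + 9 / 20) * (m / w) = D / 2 + 9 / 20 / w * m by rewrite /D; field.
by rewrite lerD2l (le_trans B).
Qed.

(** [F x] is at most [F (x + D - t)] plus the overshoot, and replacing [F (x + D - t)] by
    [F (x - t)] costs [D / 2] on average. *)
Lemma smoothing_upper (m : R) x : 0 < m -> M1 <= m ->
  bias small (fun t => F x - F (x - t)) <= (8 / 21 + 9 / 20) * (m / w).
Proof.
move=> m0 Mm; have [D D0 [e [e0 H B]]] := overshoot_optimized m0 Mm.
apply: le_trans B.
have xD : x <= x + D by lra.
have L := small_lipschitz xD; rewrite addrAC subrr add0r in L.
apply: (@le_trans _ _ (bias small (fun t => (F (x + D - t) - F (x - t)) + overshoot k e D t))).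
  apply: le_bias.
  - exact: bounded_mfun_small.
  - by apply: bounded_mfunB; [exact: bounded_mfun_cst|exact: bounded_mfun_cdfB].
  - by apply: bounded_mfunD; [apply: bounded_mfunB; exact: bounded_mfun_cdfB|exact: bounded_mfun_overshoot].
  - exact: small_ge0.
  - by move=> t; have := @overshoot_right e D x t D0 e0 H; lra.
rewrite biasD; [by rewrite lerD2r|exact: bounded_mfun_small|by apply: bounded_mfunB; exact: bounded_mfun_cdfB|exact: bounded_mfun_overshoot].
Qed.

Lemma smoothing_lower (m : R) x : 0 < m -> M1 <= m ->
  bias small (fun t => F (x - t) - F x) <= (8 / 21 + 9 / 20) * (m / w).
Proof.
move=> m0 Mm; have [D D0 [e [e0 H B]]] := overshoot_optimized m0 Mm.
apply: le_trans B.
have xD : x - D <= x by lra.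
have L := small_lipschitz xD; rewrite (_ : x - (x - D) = D) in L; last by ring.
apply: (@le_trans _ _ (bias small (fun t => (F (x - t) - F (x - D - t)) + overshoot k e D t))).
  apply: le_bias.
  - exact: bounded_mfun_small.
  - by apply: bounded_mfunB; [exact: bounded_mfun_cdfB|exact: bounded_mfun_cst].
  - by apply: bounded_mfunD; [apply: bounded_mfunB; exact: bounded_mfun_cdfB|exact: bounded_mfun_overshoot].
  - exact: small_ge0.
  - by move=> t; have := @overshoot_left e D x t D0 e0 H; lra.
rewrite biasD; [by rewrite lerD2r|exact: bounded_mfun_small|by apply: bounded_mfunB; exact: bounded_mfun_cdfB|exact: bounded_mfun_overshoot].
Qed.

End concentration.

Lemma bounded_mfun_min_norm : bounded_mfun (fun t => 2 * Num.min `|t| 1).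
Proof.
apply: bounded_mfunZ; split.
  by apply: measurable_minr => //; exact: normr_measurable.
by exists 1 => t; rewrite ger0_norm ?ge_min ?lexx ?orbT// le_min normr_ge0/=.
Qed.

(** The factor 2 is cancelled by the mean 1/2 of the uniform variable in [V]. *)
Lemma bias_min_norm : bias small (fun t => 2 * Num.min `|t| 1) <= M1.
Proof.
rewrite -[leRHS]mul1r; apply: bias_small_le; first exact: bounded_mfun_min_norm.
move=> x; have [b1 [K bK]] := bounded_mfun_min_norm.
have bmm : bounded_mfun (fun t => Num.min `|t| 1).
  have := bounded_mfunZ 2^-1 bounded_mfun_min_norm; congr bounded_mfun; apply/funext => t.
  by rewrite mulrA mulVf ?mul1r.
rewrite RintegralZl//; last exact: (bounded_mfun_integrable U (bounded_mfun_section x bmm)).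
rewrite mulrCA mul1r; have := min_norm_average x; lra.
Qed.

(** Large jumps cost [weight large] and the Lipschitz term costs [M1] on the small ones; together
    they are exactly one [moment]. *)
Lemma bias_gap_le G (H : R -> R) m : bounded_mfun G -> bounded_mfun H -> (forall t, `|G t| <= 1) ->
  (forall t, G t <= 2 * Num.min `|t| 1 + H t) ->
  bias small H <= m -> bias (fun=> 1) G <= moment + m.
Proof.
move=> bG bH G1 GH Hm.
have -> : (fun=> 1) = (fun x => small x + large x).
  by apply/funext => x; rewrite /large addrC subrK.
rewrite bias_splitW//; [|exact: bounded_mfun_small|exact: bounded_mfun_large].
have h1 : bias large G <= weight large.
  rewrite -[leRHS]mul1r -(bias_cst _ bounded_mfun_large); apply: le_bias => //.
  - exact: bounded_mfun_large.
  - exact: bounded_mfun_cst.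
  - exact: large_ge0.
  - by move=> t; rewrite (le_trans (ler_norm _)).
have h2 : bias small G <= M1 + m.
  apply: (@le_trans _ _ (bias small (fun t => 2 * Num.min `|t| 1 + H t))).
    apply: le_bias => //.
    - exact: bounded_mfun_small.
    - by apply: bounded_mfunD => //; exact: bounded_mfun_min_norm.
  rewrite biasD//; [|exact: bounded_mfun_small|exact: bounded_mfun_min_norm].
  by rewrite lerD// bias_min_norm.
rewrite momentE; lra.
Qed.

Lemma zero_bias_berry_esseen (M : R) x : 0 < M -> moment <= M ->
  `|F x - Phi x| <= 18546 / 10000 * M.
Proof.
move=> M0 mM.
have f1 := strict_cdf_le1 x; have f2 := strict_cdf_ge0 x.
have p1 := Phi_le1 x; have p2 := Phi_ge0 x.
have [Mbig|Mlt] := leP 1 M; first by rewrite ler_norml; lra.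
have M1_ge0 : 0 <= M1.
  by apply: weight_ge0; [exact: bounded_mfun_small_norm|move=> y; rewrite mulr_ge0// small_ge0].
have q0 : 0 <= weight large by apply: weight_ge0; [exact: bounded_mfun_large|exact: large_ge0].
have mE := momentE.
have wq := weight_small_large.
have w0 : 0 < w by lra.
have m0 : 0 < w * M by rewrite mulr_gt0.
(* Writing [q] for [weight large], [M1 <= M - q <= M - q * M = w * M] because [M < 1]. With
   [m = w * M] the quotient [m / w] is [M], so the division by [w] costs nothing. *)
have Mm : M1 <= w * M.
  have -> : w = 1 - weight large by lra.
  have : 0 <= weight large * (1 - M) by rewrite mulr_ge0//; lra.
  lra.
have E : w * M / w = M by rewrite mulrC mulKf// gt_eqF.
have h1 := @smoothing_upper w0 _ x m0 Mm; rewrite E in h1.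
have h2 := @smoothing_lower w0 _ x m0 Mm; rewrite E in h2.
have bG := bounded_mfun_stein_gap x.
have g1 : bias (fun=> 1) (stein_gap x) <= moment + (8 / 21 + 9 / 20) * M.
  apply: (@bias_gap_le _ (fun t => F x - F (x - t))) => //.
  - by apply: bounded_mfunB; [exact: bounded_mfun_cst|exact: bounded_mfun_cdfB].
  - exact: stein_gap_le1.
  - exact: stein_gap_le.
have g2 : bias (fun=> 1) (fun t => - 1 * stein_gap x t) <= moment + (8 / 21 + 9 / 20) * M.
  apply: (@bias_gap_le _ (fun t => F (x - t) - F x)) => //.
  - exact: bounded_mfunZ.
  - by apply: bounded_mfunB; [exact: bounded_mfun_cdfB|exact: bounded_mfun_cst].
  - by move=> t; rewrite mulN1r normrN stein_gap_le1.
  - by move=> t; rewrite mulN1r; exact: stein_gap_ge.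
rewrite biasZ// in g2; last exact: bounded_mfun1.
rewrite strict_cdf_sub_Phi ler_norml.
move: (bias _ _) moment g1 g2 mM M0 => b mo g1 g2 mM M0.
by apply/andP; split; lra.
Qed.

End zero_bias.

(** * Rescaling the steps *)

Section scaling.
Context d (T : measurableType d) {R : realType} (P : probability T R).
Variables (X : nat -> {RV P >-> R}) (N : T -> nat) (c : R).
Hypothesis c0 : 0 < c.

Definition scaled_step i w : R := X i w / c.

Lemma measurable_scaled_step i : measurable_fun setT (scaled_step i).
Proof. by apply: measurable_funM => //; exact: measurable_funPT. Qed.

HB.instance Definition _ i :=
  isMeasurableFun.Build _ _ _ _ (scaled_step i) (measurable_scaled_step i).

Definition scaled_rv i : {RV P >-> R} := scaled_step i.

Lemma measurable_div_preimage (B : set R) : measurable B ->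
  measurable ((fun x : R => x / c) @^-1` B).
Proof.
move=> mB; rewrite -[X in measurable X]setTI.
have : measurable_fun setT (fun x : R => x / c) by exact: measurable_funM.
exact.
Qed.

Lemma scaled_ident_distr : ident_distr P (fun i => X i) -> ident_distr P (fun i => scaled_rv i).
Proof. by move=> H i B mB; exact: (H i _ (measurable_div_preimage mB)). Qed.

Lemma scaled_indep : indep_count_seq P N (fun i => X i) ->
  indep_count_seq P N (fun i => scaled_rv i).
Proof.
move=> H n C B mB.
exact: (H n C (fun i => (fun x : R => x / c) @^-1` B i) (fun i => measurable_div_preimage (mB i))).
Qed.

Lemma scaled_random_sum w : random_sum N (fun i => scaled_rv i) w = random_sum N (fun i => X i) w / c.
Proof. by rewrite /random_sum mulr_suml. Qed.

End scaling.

(** * Measurability and lower bound for functions of the class *)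

Section classG_bound.
Context {R : realType}.
Variable g : R -> R.
Hypothesis gG : classG g.

Lemma classG_norm x : g x = g `|x|.
Proof. by have [gN _ _ _ _] := gG; have [x0|x0] := ler0P x; rewrite ?gN. Qed.

Lemma measurable_classG : measurable_fun setT g.
Proof.
have [gN g0 gp gm _] := gG.
(* Monotonicity in the class concerns positive arguments only, so [g 0] may be out of order. [G] is
   monotone on the whole line, and the value at 0 is put back separately. *)
pose G t := if t <= 0 then 0 else g t.
have mG : measurable_fun setT G.
  apply: nondecreasing_measurable => // s t st; rewrite /G.
  case: (leP s 0) => s0; case: (leP t 0) => t0 //.
  - by move: (lt_le_trans s0 st); rewrite ltNge t0.
  - exact: gm.
have -> : g = (fun x => if `|x| <= 0 then g 0 else G `|x|).
  apply/funext => x; rewrite /G; case: ifP => [|x0].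
    by rewrite normr_le0 => /eqP ->.
  by rewrite x0 classG_norm.
apply: measurable_fun_ifT => //.
- by apply: measurable_fun_ler => //; exact: normr_measurable.
- exact: (measurableT_comp mG (@normr_measurable R setT)).
Qed.

(** For [|x| >= c] this is the monotonicity of [g]; for [|x| < c] it is the monotonicity of
    [x / g x]. *)
Lemma classG_min (c x : R) : 0 < c -> g c * Num.min 1 `|x / c| <= g x.
Proof.
move=> c0; have [gN g0 gp gm gd] := gG; rewrite [g x]classG_norm.
have [x0|x0] := eqVneq x 0.
  by rewrite x0 mul0r normr0 (min_idPr _)// mulr0.
have ax : 0 < `|x| by rewrite normr_gt0.
rewrite normrM normfV (gtr0_norm c0).
case: (leP 1 (`|x| / c)) => xc.
  rewrite mulr1; apply: gm => //.
  by rewrite ler_pdivlMr// mul1r in xc.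
have xc' : `|x| <= c by rewrite ltr_pdivrMr// mul1r in xc; exact: ltW.
have := gd _ _ ax xc'.
have gx := gp _ ax; have gc := gp _ c0.
rewrite ler_pdivrMr// mulrAC ler_pdivlMr// => h.
by rewrite mulrA ler_pdivrMr// mulrC [leRHS]mulrC.
Qed.

End classG_bound.

Theorem theorem8 (d : measure_display) (T : measurableType d) (R : realType)
    (P : probability T R) (X : nat -> {RV P >-> R}) (N : T -> nat)
    (sigma lambda : R) (g : R -> R) :
  ident_distr P (fun i => X i) ->
  indep_count_seq P N (fun i => X i) ->
  ('E_P[X 0%N] = 0)%E ->
  0 < sigma ->
  ('E_P[(fun w => (X 0%N w ^+ 2)%R)] = (sigma ^+ 2)%:E)%E ->
  0 < lambda ->
  (forall k : nat, measurable (N @^-1` [set k])) ->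
  (forall k : nat, P (N @^-1` [set k]) = (poisson_pmf lambda k)%:E) ->
  classG g ->
  ('E_P[(fun w => (X 0%N w ^+ 2 * g (X 0%N w))%R)] < +oo)%E ->
  forall x : R,
    `| fine (P [set w | random_sum N (fun i => X i) w < x * sigma * Num.sqrt lambda])
       - std_normal_cdf x |
    <= (18546 / 10000) * fine ('E_P[(fun w => (X 0%N w ^+ 2 * g (X 0%N w))%R)])%E
       / (sigma ^+ 2 * g (sigma * Num.sqrt lambda)).
Proof.
move=> Xid NX EX s0 EX2 l0 mN Npois gG EXg x.
pose c := sigma * Num.sqrt lambda.
have sl0 : 0 < Num.sqrt lambda by rewrite sqrtr_gt0.
have c0 : 0 < c by rewrite mulr_gt0.
have cn0 : c != 0 by rewrite gt_eqF.
have c2 : c ^+ 2 = sigma ^+ 2 * lambda by rewrite exprMn sqr_sqrtr// ltW.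
pose Y := scaled_rv X c.
have Yid : ident_distr P (fun i => Y i) by exact: scaled_ident_distr.
have NY : indep_count_seq P N (fun i => Y i) by exact: scaled_indep.
have mX : measurable_fun setT (X 0%N : T -> R) by exact: measurable_funPT.
have mX2 : measurable_fun setT (fun w => X 0%N w ^+ 2) by exact: measurable_funX.
have mg := measurable_classG gG.
have [gN g0 gp gm gd] := gG.
have mXg : measurable_fun setT (fun w => X 0%N w ^+ 2 * g (X 0%N w)).
  by apply: measurable_funM => //; exact: (measurableT_comp mg mX).
have Xg0 w : 0 <= X 0%N w ^+ 2 * g (X 0%N w) by rewrite mulr_ge0// sqr_ge0.
have iX2 : P.-integrable setT (EFin \o (fun w => X 0%N w ^+ 2)).
  apply/integrableP; split; first exact/measurable_EFinP.
  under eq_integral do rewrite /= ger0_norm ?sqr_ge0//.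
  by move: EX2; rewrite unlock => ->; rewrite ltry.
have iXg : P.-integrable setT (EFin \o (fun w => X 0%N w ^+ 2 * g (X 0%N w))).
  apply/integrableP; split; first exact/measurable_EFinP.
  under eq_integral do rewrite /= (ger0_norm (Xg0 _)).
  by move: EXg; rewrite unlock.
have iX : P.-integrable setT (EFin \o (X 0%N : T -> R)).
  apply: (@dominated_integrable_real _ _ _ _ _ (fun w => 1 + X 0%N w ^+ 2)) => //.
  - have := integrableD measurableT (@bounded_integrable R _ _ P (cst 1) `|1| (measurable_cst _) (fun=> lexx _)) iX2.
    by apply: eq_integrable.
  - move=> w; rewrite -(real_normK (num_real (X 0%N w))).
    have := sqr_ge0 (`|X 0%N w| - 1); have := normr_ge0 (X 0%N w).
    move: `|X 0%N w| => y y0; rewrite !expr2; nra.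
have mY : measurable_fun setT (scaled_step X c 0) by exact: measurable_scaled_step.
pose rho := step_law Y.
have iY : P.-integrable setT (EFin \o Y 0%N).
  have := integrableZl measurableT c^-1 iX; apply: eq_integrable => // w _.
  by rewrite /= /Y /scaled_rv /scaled_step mulrC.
have Yw w : Y 0%N w ^+ 2 = X 0%N w ^+ 2 / c ^+ 2 by rewrite -exprVn -exprMn.
have iY2 : P.-integrable setT (EFin \o (fun w => Y 0%N w ^+ 2)).
  have := integrableZl measurableT (c ^- 2) iX2; apply: eq_integrable => // w _.
  by rewrite /= Yw mulrC.
have rho_pushforward (f : R -> R) : measurable_fun setT f ->
    P.-integrable setT (EFin \o (fun w => f (Y 0%N w))) ->
    rho.-integrable setT (EFin \o f) /\ \int[rho]_y f y = \int[P]_w f (Y 0%N w).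
  move=> mf fi; have mf' : measurable_fun setT (EFin \o f) by exact/measurable_EFinP.
  split.
  - exact: (@integrable_pushforward _ _ _ _ R (scaled_step X c 0) mY P setT (EFin \o f) mf' fi).
  - congr fine.
    exact: (@integral_pushforward _ _ _ _ R (scaled_step X c 0) mY P setT (EFin \o f) mf' fi).
have [rho_int rho_mean] := rho_pushforward id (@measurable_id _ _ _) iY.
have [rho_sq rho_var] := rho_pushforward (fun y => y ^+ 2) (measurable_funX 2 (@measurable_id _ _ _)) iY2.
pose zeta := compound_law Y mN.
have zeta_int : zeta.-integrable setT (EFin \o id).
  exact: (integrable_compound_law Yid NY mN rho_int l0 Npois).
have mean0 : \int[rho]_y y = 0.
  rewrite rho_mean; transitivity (\int[P]_w (X 0%N w / c)); first by [].
  rewrite RintegralZr// /Rintegral.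
  by move: EX; rewrite unlock => ->; rewrite mul0r.
have var1 : lambda * \int[rho]_y y ^+ 2 = 1.
  rewrite rho_var; transitivity (lambda * \int[P]_w (X 0%N w ^+ 2 / c ^+ 2)).
    by congr (_ * _); apply: eq_Rintegral => w _; exact: Yw.
  rewrite RintegralZr// /Rintegral.
  move: EX2; rewrite unlock => -> /=; rewrite c2; field.
  by rewrite !gt_eqF.
have zeta_bias (f : R -> R) (K : R) : measurable_fun setT f -> (forall s, `|f s| <= K) ->
    \int[zeta]_s (s * f s) = lambda * \int[zeta]_s \int[rho]_y (y * f (s + y)).
  exact: (size_bias_compound_law Yid NY mN rho_int l0 Npois).
have cdfE : strict_cdf zeta x =
    fine (P [set w | random_sum N (fun i => X i) w < x * sigma * Num.sqrt lambda]).
  rewrite /strict_cdf /Rintegral; congr fine.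
  have -> : (\int[zeta]_s ((s < x)%R%:R)%:E = \int[zeta]_s (\1_`]-oo, x[ s)%:E)%E.
    apply: eq_integral => s _; congr EFin; rewrite indicE; congr (_%:R).
    by case: (boolP (s < x)) => h; [rewrite mem_set//= | rewrite memNset//=; apply/negP]; rewrite in_itv/=.
  have sumE w : compound_sum Y N w = random_sum N (fun i => X i) w / c.
    exact: (@scaled_random_sum _ _ _ P X N c w).
  rewrite integral_indic// setIT.
  congr (P _); apply/seteqP; split => w /=;
    by rewrite in_itv/= sumE ltr_pdivrMr// mulrA.
rewrite -cdfE.
set E := fine _; set q := _ * g _.
have gc0 : 0 < g c by exact: gp.
have q0 : 0 < q by rewrite mulr_gt0// exprn_gt0.
have E0 : 0 <= E.
  by apply: fine_ge0; rewrite unlock; apply: integral_ge0 => w _; rewrite lee_fin mulr_ge0// sqr_ge0.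
have moment_le : moment rho lambda <= E / q.
  rewrite ler_pdivlMr// /moment /weight.
  have mm : measurable_fun setT (fun y : R => y ^+ 2 * Num.min 1 `|y|).
    apply: measurable_funM; first exact: measurable_funX.
    by apply: measurable_minr => //; exact: normr_measurable.
  have im : P.-integrable setT (EFin \o (fun w => Y 0%N w ^+ 2 * Num.min 1 `|Y 0%N w|)).
    apply: dominated_integrable_real iY2 _ => //.
      exact: (measurableT_comp mm mY).
    move=> w; rewrite normrM ger0_norm ?sqr_ge0//.
    rewrite -[leRHS]mulr1 ler_wpM2l ?sqr_ge0//.
    by rewrite ger0_norm ?ge_min ?lexx// le_min ler01 normr_ge0.
  rewrite (rho_pushforward _ mm im).2.
  rewrite mulrAC mulrC -RintegralZr//.
  rewrite /E unlock -/(Rintegral _ _ _); apply: le_Rintegral => //.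
    have := integrableZl measurableT (lambda * q) im; apply: eq_integrable => // w _.
    by rewrite /= -EFinM [in LHS]mulrC.
  move=> w _; rewrite /= /Y /scaled_rv /= /scaled_step.
  (* As [c ^+ 2 = sigma ^+ 2 * lambda], the factor [lambda * q / c ^+ 2] equals [g c]. *)
  have -> : (X 0%N w / c) ^+ 2 * Num.min 1 `|X 0%N w / c| * (lambda * q) =
      X 0%N w ^+ 2 * (g c * Num.min 1 `|X 0%N w / c|).
    rewrite exprMn exprVn c2 /q -/c; field.
    by rewrite !gt_eqF.
  by rewrite ler_wpM2l ?sqr_ge0// classG_min.
(* The general bound wants [M > 0]; the slack [e / 2] provides it without showing [E / q > 0], and
   half of [e] is enough since the constant is below 2. *)
apply/ler_addgt0Pr => e e0.
have M0 : 0 < E / q + e / 2 by rewrite ltr_wpDl ?divr_gt0// divr_ge0// ltW.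
have mM : moment rho lambda <= E / q + e / 2 by rewrite (le_trans moment_le)// lerDl divr_ge0// ltW.
apply: (le_trans (zero_bias_berry_esseen l0 rho_int rho_sq mean0 var1 zeta_int zeta_bias x M0 mM)).
rewrite -[X in _ <= X + _]mulrA; move: (E / q) => r; lra.
Qed.
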